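(* Let $q$ be a prime power and let $G(\mathcal O)$ act on the set $\mathcal L=\mathcal L_+\cup\mathcal L_-$ of non-tangent lines of the conic $\mathcal O$ in $\mathrm{PG}(2,q)$ (notation in the context). (i) The orbits of $G(\mathcal O)$ on $\mathcal L\times\mathcal L$ form a weakly symmetric coherent configuration $\mathcal R(q)$. (ii) The restriction of $\mathcal R(q)$ to the fibre $\mathcal L_+$ is an association scheme with $q/2$ classes if $q$ is even and $(q+1)/2$ classes if $q$ is odd. Its non-diagonal relations are precisely the sets $\mathcal R_{\{\lambda,\lambda^{-1}\}}(1,1)$ with $\lambda\in\mathbf B_0$. (iii) The restriction of $\mathcal R(q)$ to the fibre $\mathcal L_-$ is an association scheme with $q/2-1$ classes if $q$ is even and $(q-1)/2$ classes if $q$ is odd. Its non-diagonal relations are precisely the sets $\mathcal R_{\{\lambda,\lambda^{-1}\}}(-1,-1)$ with $\lambda\in\mathbb F_q\setminus\{0,1\}$.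
   Context: Let $q$ be a prime power. Projective plane and conic. - Points of $\mathrm{PG}(2,K)$ are nonzero column vectors $(X,Y,Z)^\top$ up to nonzero scalars. - For a nonzero $(a,b,c)$, the line $(a,b,c)^\perp$ is $\{(X,Y,Z)^\top : aX+bY+cZ=0\}$. - $\mathrm{PG}(2,q)$ is regarded as a subset of $\mathrm{PG}(2,q^2)$. - For $\xi\in\mathbb F_{q^m}$ put $P_\xi=(\xi,\xi^2,1)^\top$, and put $P_\infty=(0,1,0)^\top$. - $\mathcal O_{q^m}=\{P_\xi:\xi\in\mathbb F_{q^m}\cup\{\infty\}\}$, and $\mathcal O=\mathcal O_q$. Line types. - A line of $\mathrm{PG}(2,q)$ is secant, tangent or exterior if it meets $\mathcal O$ in $2$, $1$ or $0$ points, respectively. - $\mathcal L_+=\mathcal L_1$ is the set of secant lines, $\mathcal L_-=\mathcal L_{-1}$ is the set of exterior lines, and $\mathcal L=\mathcal L_+\cup\mathcal L_-$. - Each $\ell\in\mathcal L$, viewed in $\mathrm{PG}(2,q^2)$, meets $\mathcal O_{q^2}$ in exactly two points $P_\alpha,P_\beta$. The group. - $\mathrm{PGL}(2,q)$ embeds in $\mathrm{PGL}(3,q)$ via $$\begin{pmatrix}a&b\\c&d\end{pmatrix}\mapsto\begin{pmatrix}ad+bc&ac&bd\\2ab&a^2&b^2\\2cd&c^2&d^2\end{pmatrix}.$$ - The image $G(\mathcal O)$ is the stabilizer of $\mathcal O$ in $\mathrm{PGL}(3,q)$, and it acts on $\mathcal L$. Cross-ratio. - Identify $x\in\mathbb F_{q^2}$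 with $v_x=(x,1)^\top$ and $\infty$ with $v_\infty=(1,0)^\top$. - For $\alpha,\beta,\gamma,\delta\in\mathbb F_{q^2}\cup\{\infty\}$, no three equal, $\rho(\alpha,\beta,\gamma,\delta)\in\mathbb F_{q^2}\cup\{\infty\}=\mathrm{PG}(1,q^2)$ is the point $(\det(v_\alpha,v_\gamma)\det(v_\beta,v_\delta),\ \det(v_\alpha,v_\delta)\det(v_\beta,v_\gamma))^\top$. For finite entries this equals $\frac{(\alpha-\gamma)(\beta-\delta)}{(\alpha-\delta)(\beta-\gamma)}$. - For distinct $\ell,m\in\mathcal L$ with $\ell\cap\mathcal O_{q^2}=\{P_\alpha,P_\beta\}$ and $m\cap\mathcal O_{q^2}=\{P_\gamma,P_\delta\}$, set $\rho(\ell,m)=\{r,r^{-1}\}$ with $r=\rho(\alpha,\beta,\gamma,\delta)$, where $0^{-1}=\infty$. Relations and parameter sets. - For $\epsilon,\phi\in\{1,-1\}$: $\mathcal R_{\{\lambda,\lambda^{-1}\}}(\epsilon,\phi)=\{(\ell,m)\in\mathcal L_\epsilon\times\mathcal L_\phi:\ell\ne m,\ \rho(\ell,m)=\{\lambda,\lambda^{-1}\}\}$. - $\mathbf B_0=(\mathbb F_q\cup\{\infty\})\setminus\{1\}$. Coherent configurations. - A coherent configuration on a finite set $X$ is a partition $\mathcal R$ of $X\times X$ such that: some members of $\mathcal R$ partition the diagonal; $\mathcal R$ is closed under transposition; and for $R_i,R_j,R_k\in\mathcal R$ the number of $z$ with $(x,z)\in R_i$, $(z,y)\in R_j$ is the same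 for all $(x,y)\in R_k$. - The fibres are the sets $Y$ with $\{(y,y):y\in Y\}\in\mathcal R$. - It is weakly symmetric if its restriction to each fibre consists of symmetric relations. - A (symmetric) association scheme is a coherent configuration all of whose relations are symmetric; the number of classes is the number of non-diagonal relations. *)

(* Defs.v *)
From HB Require Import structures.
From mathcomp Require Import all_boot all_order all_algebra.

Set Implicit Arguments.
Unset Strict Implicit.
Unset Printing Implicit Defensive.

Import GRing.Theory.
Local Open Scope ring_scope.

Definition prime_power (q : nat) : Prop :=
  exists p n : nat, [/\ prime p, (0 < n)%N & q = (p ^ n)%N].

Section ProjectivePlane.

Variable K : finFieldType.

(* Vectors and matrices up to nonzero scalars are encoded by their classes.   *)
Definition pclass (m n : nat) (A : 'M[K]_(m, n)) : {set 'M[K]_(m, n)} :=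
  [set a *: A | a in [set a : K | a != 0]].

Definition point : finType := {set 'cV[K]_3}.

(* The row vector u = (a, b, c) has u *m (X, Y, Z)^T = aX + bY + cZ.          *)
Definition line (u : 'rV[K]_3) : {set point} :=
  [set pclass v | v : 'cV[K]_3 & (v != 0) && (u *m v == 0)].

Definition lines : {set {set point}} :=
  [set line u | u : 'rV[K]_3 & u != 0].

(* K together with infinity is option K, where None stands for infinity.      *)
Definition conic_point (xi : option K) : point :=
  pclass (\col_(i < 3)
    (if xi is Some x then [:: x; x ^+ 2; 1] else [:: 0; 1; 0])`_i).

Definition conic : {set point} := [set conic_point xi | xi : option K].

Definition secant_lines : {set {set point}} :=
  [set l in lines | #|l :&: conic| == 2%N].

Definition exterior_lines : {set {set point}} :=
  [set l in lines | #|l :&: conic| == 0%N].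

Definition nontangent_lines : {set {set point}} :=
  secant_lines :|: exterior_lines.

Definition conic_mx (A : 'M[K]_2) : 'M[K]_3 :=
  let a := A 0 0 in let b := A 0 1 in let c := A 1 0 in let d := A 1 1 in
  \matrix_(i < 3, j < 3)
    (nth [::] [:: [:: a * d + b * c; a * c;  b * d ];
                  [:: a * b *+ 2;    a ^+ 2; b ^+ 2];
                  [:: c * d *+ 2;    c ^+ 2; d ^+ 2]] i)`_j.

(* A member of PGL(n, K) is the class of an invertible matrix.                *)
Definition conic_group : {set {set 'M[K]_3}} :=
  [set pclass (conic_mx A) | A : 'M[K]_2 & A \in unitmx].

(* For classes, [M] * [v] = [M v] is the elementwise product of sets.         *)
Definition act_point (g : {set 'M[K]_3}) (P : point) : point :=
  [set M *m v | M in g, v in P].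

Definition act_line (g : {set 'M[K]_3}) (l : {set point}) : {set point} :=
  [set act_point g P | P in l].

Definition line_orbital (lm : {set point} * {set point}) :
    {set {set point} * {set point}} :=
  [set (act_line g lm.1, act_line g lm.2) | g in conic_group].

Definition conic_configuration : {set {set {set point} * {set point}}} :=
  [set line_orbital lm | lm in setX nontangent_lines nontangent_lines].

Definition pvec (x : option K) : 'cV[K]_2 :=
  \col_(i < 2) (if x is Some a then [:: a; 1] else [:: 1; 0])`_i.

Definition pdet (x y : option K) : K :=
  \det (row_mx (pvec x) (pvec y) : 'M[K]_2).

(* The element of option K identified with the point (x, y)^T of PG(1, K).    *)
Definition pratio (x y : K) : option K :=
  if y == 0 then None else Some (x / y).

Definition pinv (x : option K) : option K :=
  if x is Some a then pratio 1 a else Some 0.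

Definition cross_ratio (al be ga de : option K) : option K :=
  pratio (pdet al ga * pdet be de) (pdet al de * pdet be ga).

End ProjectivePlane.

Section LineCrossRatio.

Variables (F K : finFieldType) (iota : {rmorphism F -> K}).

(* The line of PG(2, K) with the same equation as the line l of PG(2, F); the *)
(* union ranges over proportional u, all giving the same line.                *)
Definition line_ext (l : {set point F}) : {set point K} :=
  \bigcup_(u : 'rV[F]_3 | (u != 0) && (line u == l)) line (map_mx iota u).

Definition line_cross_ratio (l m : {set point F}) (S : {set option K}) : bool :=
  [exists al : option K, exists be : option K,
   exists ga : option K, exists de : option K,
     [&& line_ext l :&: conic K == [set conic_point al; conic_point be],
         line_ext m :&: conic K == [set conic_point ga; conic_point de]
       & S == [set cross_ratio al be ga de; pinv (cross_ratio al be ga de)]]].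

(* R_{lambda, lambda^-1}(eps, phi), where A = L_eps and B = L_phi.            *)
Definition cross_ratio_rel (A B : {set {set point F}}) (lambda : option K) :
    {set {set point F} * {set point F}} :=
  [set lm in setX A B |
     (lm.1 != lm.2) && line_cross_ratio lm.1 lm.2 [set lambda; pinv lambda]].

End LineCrossRatio.

Section CoherentConfigurations.

Variable T : finType.
Implicit Types (X Y : {set T}) (r : {set T * T}) (R : {set {set T * T}}).

Definition diag X : {set T * T} := [set (x, x) | x in X].

Definition transpose r : {set T * T} := [set (p.2, p.1) | p in r].

Definition symmetric_rel r : Prop := transpose r = r.

Definition coherent_configuration X R : Prop :=
  [/\ partition R (setX X X),
      exists2 D : {set {set T * T}}, D \subset R & partition D (diag X),
      forall r, r \in R -> transpose r \in R
    & forall ri rj rk, ri \in R -> rj \in R -> rk \in R ->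
        exists n : nat, forall x y, (x, y) \in rk ->
          #|[set z | ((x, z) \in ri) && ((z, y) \in rj)]| = n].

Definition fibres R : {set {set T}} := [set Y : {set T} | diag Y \in R].

Definition restriction R Y : {set {set T * T}} :=
  [set r :&: setX Y Y | r in R] :\ set0.

Definition weakly_symmetric R : Prop :=
  forall Y, Y \in fibres R -> forall r, r \in restriction R Y -> symmetric_rel r.

Definition association_scheme X R : Prop :=
  coherent_configuration X R /\ (forall r, r \in R -> symmetric_rel r).

Definition nondiagonal_relations X R : {set {set T * T}} :=
  [set r in R | ~~ (r \subset diag X)].

Definition num_classes X R : nat := #|nondiagonal_relations X R|.

End CoherentConfigurations.

(* Main.v *)
Require Import Defs.
From mathcomp Require Import all_boot all_order all_algebra all_field.
From mathcomp Require Import ring zify.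

(* A non-tangent line is determined by the pair it cuts out on the conic over  *)
(* K = F_(q^2): two points of PG(1, q) for a secant line, two points swapped   *)
(* by Frobenius sigma for an exterior line.  Let two pairs of lines of one     *)
(* type have the same cross ratio.  Then some M in PGL(2, K) maps the first    *)
(* four points to the other four; sigma(M) does the same, and since a          *)
(* projectivity is determined by three points, sigma(M) = c M, so that a       *)
(* multiple of M has entries in F.  Hence the orbits of distinct pairs of      *)
(* lines are the level sets of {r, 1/r}, and the symmetry of the cross ratio   *)
(* under exchange of the two lines makes them symmetric.  The cross ratio is   *)
(* fixed by sigma, hence lies in PG(1, q); all admissible values occur, for    *)
(* exterior lines because the norm from K to F is surjective.  The classes are *)
(* thus counted by the orbits of r |-> 1/r, whose only possible fixed point    *)
(* among the parameters is -1.                                                 *)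

(** Coherence is formal. The orbitals of any finite group action form a coherent configuration
    ([orbitals_coherent]), its restriction to an invariant set consists of the orbitals on that set
    ([restriction_orbitals]), and transitivity makes the set a fibre ([orbital_diag]).

    Geometry enters by reading a line as a binary quadratic form [quad], whose roots over [K] are
    the parameters of the two points on the conic ([typed_linesP]); the group acts on these roots by
    [mobius]. On each fibre the cross ratio set is an invariant of orbitals
    ([line_cross_ratio_orbital]), and it is a complete one ([mem_orbital_cross_ratio]), because a
    projectivity over [K] that matches the points descends to [F]
    ([conj_type_quadruple_transitive]). Symmetry follows from [cross_ratioC].

    The values that occur are found by [line_cross_ratio_rational] and [exists_lines_cross_ratio].
    Twice the number of classes is the number of these values plus the number of values equal to
    their inverse ([num_classes_orbitals]). *)

Set Implicit Arguments.
Unset Strict Implicit.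
Unset Printing Implicit Defensive.

Import GRing.Theory.
Local Open Scope ring_scope.

(** * Orbitals of a finite group *)

Section Orbitals.

Variables (T gT : finType) (G : {set gT}) (act : gT -> T -> T).

(** The members of [G] will be classes of matrices, multiplied as sets, and [act] is meaningless
    outside [X]. The group axioms are therefore stated through their effect on [X] only, with no
    product on [gT]. *)
Definition acts_as_group (X : {set T}) : Prop :=
  [/\ forall g x, g \in G -> x \in X -> act g x \in X,
      exists2 e, e \in G & forall x, x \in X -> act e x = x,
      forall g h, g \in G -> h \in G ->
        exists2 k, k \in G & forall x, x \in X -> act k x = act g (act h x)
    & forall g, g \in G ->
        exists2 h, h \in G & forall x, x \in X -> act h (act g x) = x].

Definition orbital (xy : T * T) : {set T * T} :=
  [set (act g xy.1, act g xy.2) | g in G].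

Definition orbitals (X : {set T}) : {set {set T * T}} :=
  [set orbital xy | xy in setX X X].

Variable X : {set T}.
Hypothesis actX : acts_as_group X.

Lemma orbitalP x y x' y' :
  reflect (exists2 g, g \in G & x' = act g x /\ y' = act g y)
          ((x', y') \in orbital (x, y)).
Proof.
apply: (iffP imsetP) => [[g Gg [-> ->]]|[g Gg [-> ->]]]; by exists g.
Qed.

Lemma orbital_refl x y : x \in X -> y \in X -> (x, y) \in orbital (x, y).
Proof.
by case: actX => _ [e Ge e1] _ _ Xx Xy; apply/orbitalP; exists e => //; rewrite !e1.
Qed.

Lemma orbital_sub xy : xy \in setX X X -> orbital xy \subset setX X X.
Proof.
case: xy => x y; case: actX => gX _ _ _ /setXP[Xx Xy].
by apply/subsetP => -[x' y'] /orbitalP[g Gg [-> ->]]; rewrite in_setX !gX.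
Qed.

Lemma orbital_eq xy xy' :
  xy \in setX X X -> xy' \in orbital xy -> orbital xy' = orbital xy.
Proof.
case: xy xy' => x y [x' y'] /setXP[Xx Xy] /orbitalP[g Gg [-> ->]].
case: actX => gX _ gM gV.
apply/setP => -[x1 y1]; apply/orbitalP/orbitalP => -[h Gh [-> ->]].
  by have [k Gk kE] := gM h g Gh Gg; exists k; rewrite // !kE.
have [g' Gg' g'E] := gV g Gg; have [k Gk kE] := gM h g' Gh Gg'.
by exists k; rewrite // !kE ?gX // !g'E.
Qed.

Lemma orbital_eqE xy xy' : xy \in setX X X -> xy' \in setX X X ->
  (orbital xy == orbital xy') = (xy' \in orbital xy).
Proof.
move=> Xxy Xxy'; apply/eqP/idP => [->|/orbital_eq->//].
by case: xy' Xxy' => x y /setXP[Xx Xy]; apply: orbital_refl.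
Qed.

Lemma partition_orbitals : partition (orbitals X) (setX X X).
Proof.
apply/and3P; split.
- rewrite eqEsubset; apply/andP; split; apply/subsetP => xy.
    by case/bigcupP => r /imsetP[xy' Xxy' ->]; apply/subsetP/orbital_sub.
  move=> Xxy; apply/bigcupP; exists (orbital xy); first exact: imset_f.
  by rewrite -orbital_eqE.
- apply/trivIsetP => _ _ /imsetP[xy Xxy ->] /imsetP[xy' Xxy' ->].
  apply: contraR => /pred0Pn[zt /andP[/= zt1 zt2]].
  by rewrite -(orbital_eq Xxy zt1) -(orbital_eq Xxy' zt2).
- apply/imsetP => -[[x y] /setXP[Xx Xy]] /setP/(_ (x, y)).
  by rewrite orbital_refl // inE.
Qed.

Lemma mem_orbitals x y r : r \in orbitals X -> (x, y) \in r ->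
  [/\ x \in X, y \in X & r = orbital (x, y)].
Proof.
case/imsetP=> xy' Xxy' -> xyr.
have /setXP[Xx Xy] := subsetP (orbital_sub Xxy') _ xyr.
by rewrite (orbital_eq Xxy' xyr).
Qed.

(** Intersection numbers are constant because [g] injects the points [z] counted for [(x, y)] into
    those counted for [(act g x, act g y)], and an inverse of [g] gives the opposite inequality. *)
Lemma orbitals_coherent : coherent_configuration X (orbitals X).
Proof.
have [gX _ gM gV] := actX.
split; first exact: partition_orbitals.
- exists [set r in orbitals X | r \subset diag X].
    by apply/subsetP => r; rewrite inE => /andP[].
  have /and3P[/eqP covX trivX X0] := partition_orbitals.
  have subR : [set r in orbitals X | r \subset diag X] \subset orbitals X.
    by apply/subsetP => r; rewrite inE => /andP[].
  apply/and3P; split; last 1 first.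
  + by apply: contra X0; apply/subsetP.
  + rewrite eqEsubset; apply/andP; split.
      by apply/bigcupsP => r; rewrite inE => /andP[].
    apply/subsetP => _ /imsetP[x Xx ->]; apply/bigcupP; exists (orbital (x, x)).
      rewrite inE imset_f ?in_setX ?Xx //=.
      apply/subsetP => -[y z] /orbitalP[g Gg [-> ->]].
      by apply: (imset_f (fun x => (x, x))); apply: gX.
    exact: orbital_refl.
  + exact: trivIsetS subR trivX.
- move=> _ /imsetP[[x y] /setXP[Xx Xy] ->].
  suff -> : transpose (orbital (x, y)) = orbital (y, x).
    by apply: imset_f; rewrite in_setX Xx Xy.
  apply/setP => -[y' x']; apply/imsetP/orbitalP.
    by case=> -[a b] /orbitalP[g Gg [-> ->]] [-> ->]; exists g.
  by case=> g Gg [-> ->]; exists (act g x, act g y) => //; apply/orbitalP; exists g.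
- move=> ri rj rk Ri Rj Rk.
  pose N xy := [set z | ((xy.1, z) \in ri) && ((z, xy.2) \in rj)].
  have NX x y z : z \in N (x, y) -> z \in X.
    by rewrite inE => /andP[/(mem_orbitals Ri)[]].
  have act_mem r g x y : r \in orbitals X -> g \in G -> (x, y) \in r ->
      (act g x, act g y) \in r.
    move=> Rr Gg /[dup] xyr /(mem_orbitals Rr)[Xx Xy ->].
    by apply/orbitalP; exists g.
  have leN x y g : x \in X -> y \in X -> g \in G ->
      (#|N (x, y)| <= #|N (act g x, act g y)|)%N.
    move=> Xx Xy Gg; have injg : {in N (x, y) &, injective (act g)}.
      have [h Gh hg] := gV g Gg.
      by move=> a b /NX Xa /NX Xb /(congr1 (act h)); rewrite !hg.
    rewrite -(card_in_imset injg); apply/subset_leq_card/subsetP.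
    move=> _ /imsetP[z zN ->]; rewrite inE; move: zN; rewrite inE /=.
    by case/andP => z1 z2; rewrite !act_mem.
  have [[x y] xyk] : exists xy, xy \in rk.
    by case/imsetP: Rk => -[x y] /setXP[Xx Xy] ->; exists (x, y); apply: orbital_refl.
  have [Xx Xy rkE] := mem_orbitals Rk xyk.
  exists #|N (x, y)| => x' y'; rewrite rkE => /orbitalP[g Gg [-> ->]].
  apply/eqP; rewrite eqn_leq leN // andbT.
  have [h Gh hg] := gV g Gg.
  by rewrite -{2}(hg x Xx) -{2}(hg y Xy) leN ?gX.
Qed.

Lemma acts_as_group_sub (Y : {set T}) : Y \subset X ->
  (forall g y, g \in G -> y \in Y -> act g y \in Y) -> acts_as_group Y.
Proof.
move=> /subsetP sYX gY; have [_ [e Ge e1] gM gV] := actX; split=> //.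
- by exists e => // y /sYX/e1.
- by move=> g h Gg Gh; have [k Gk kE] := gM g h Gg Gh; exists k => // y /sYX/kE.
- by move=> g Gg; have [h Gh hE] := gV g Gg; exists h => // y /sYX/hE.
Qed.

(** An orbital that meets [setX Y Y] stays inside it by invariance, so intersecting with [setX Y Y]
    either keeps an orbital whole or empties it. *)
Lemma restriction_orbitals (Y : {set T}) : Y \subset X ->
  (forall g y, g \in G -> y \in Y -> act g y \in Y) ->
  restriction (orbitals X) Y = orbitals Y.
Proof.
move=> sYX gY; have sYX2 := subsetP sYX; have aY := acts_as_group_sub sYX gY.
have [gX _ gM gV] := actX.
have orbY x y : x \in Y -> y \in Y -> orbital (x, y) :&: setX Y Y = orbital (x, y).
  move=> Yx Yy; apply/setIidPl/subsetP => -[x' y'] /orbitalP[g Gg [-> ->]].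
  by rewrite in_setX !gY.
apply/setP => r; apply/setD1P/imsetP.
  case=> r0 /imsetP[s Rs rE]; have [[x y]] := set0Pn _ r0.
  rewrite rE => /setIP[xys /setXP[Yx Yy]]; exists (x, y); first by rewrite in_setX Yx.
  by have [_ _ ->] := mem_orbitals Rs xys; rewrite orbY.
case=> -[x y] /setXP[Yx Yy] ->; split.
  apply/set0Pn; exists (x, y); apply/orbitalP; have [_ [e Ge e1] _ _] := aY.
  by exists e => //; rewrite !e1.
apply/imsetP; exists (orbital (x, y)); last by rewrite orbY.
by apply: imset_f; rewrite in_setX !sYX2.
Qed.

Lemma orbital_diag (Y : {set T}) y : y \in Y ->
  (forall g, g \in G -> act g y \in Y) ->
  (forall z, z \in Y -> exists2 g, g \in G & z = act g y) ->
  orbital (y, y) = diag Y.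
Proof.
move=> Yy gY tY; apply/setP => -[a b]; apply/orbitalP/imsetP.
  by case=> g Gg [-> ->]; exists (act g y); rewrite ?gY.
by case=> z /tY[g Gg ->] [-> ->]; exists g.
Qed.

End Orbitals.

(** Serves to recognise a fibre from its diagonal relation. *)
Lemma diag_inj (T : finType) : injective (@diag T).
Proof.
have dP (Y : {set T}) z : (z \in Y) = ((z, z) \in diag Y).
  by apply/idP/imsetP => [Yz|[t Yt [->]]] //; exists z.
by move=> Y Z YZ; apply/setP => z; rewrite !dP YZ.
Qed.

(** Give each element weight 1, and a fixed point weight 2. Every orbit then has total weight 2, be
    it two elements or one. *)
Lemma card_involution_orbits (T : finType) (B : {set T}) (f : T -> T) :
  {in B, forall x, f x \in B} -> {in B, involutive f} ->
  (#|[set [set x; f x] | x in B]|.*2 = #|B| + #|[set x in B | f x == x]|)%N.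
Proof.
move=> fB ff.
have -> : #|[set x in B | f x == x]| = (\sum_(x in B) (f x == x))%N.
  rewrite -sum1_card big_mkcond [RHS]big_mkcond; apply: eq_bigr => x _.
  by rewrite inE; case: (x \in B); case: (f x == x).
rewrite -[#|B|]sum1_card -big_split /=.
rewrite (partition_big_imset (fun x => [set x; f x])) /=.
rewrite (eq_bigr (fun=> 2)); first by rewrite sum_nat_const muln2.
move=> _ /imsetP[x Bx ->].
have sub y : (y \in B) && ([set y; f y] == [set x; f x]) = (y \in [set x; f x]).
  rewrite !inE; apply/andP/orP => [[By /eqP/setP/(_ y)]|[]/eqP->].
  - by rewrite !inE eqxx => /esym/orP.
  - by rewrite Bx eqxx.
  - by rewrite fB // ff // setUC eqxx.
rewrite (eq_bigl _ _ sub); have [fx|fx] := eqVneq (f x) x.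
  by rewrite fx setUid big_set1 fx eqxx.
rewrite big_setU1 ?inE 1?eq_sym // big_set1 ff // [x == _]eq_sym.
by rewrite (negPf fx).
Qed.

(** * The projective line *)

Section ProjectiveLine.

Variable K : finFieldType.
Implicit Types (x y z : option K) (v w : 'cV[K]_2) (M N : 'M[K]_2).

Definition vdet v w : K := \det (row_mx v w : 'M_2).

Lemma ord2P (i : 'I_2) : i = 0 \/ i = 1.
Proof. by case: i => [[|[|]]] //= i; [left|right]; apply/val_inj. Qed.

Lemma lift0_ord2 : lift ord0 ord0 = 1 :> 'I_2.
Proof. exact/val_inj. Qed.

Lemma row_mx2_0 v w i : (row_mx v w : 'M_2) i 0 = v i 0.
Proof. by rewrite mxE; case: splitP => // j _; rewrite ord1. Qed.

Lemma row_mx2_1 v w i : (row_mx v w : 'M_2) i 1 = w i 0.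
Proof. by rewrite mxE; case: splitP => [[[]]|] // j _; rewrite ord1. Qed.

Lemma mulmx2E n (M : 'M[K]_2) (B : 'M[K]_(2, n)) i j :
  (M *m B) i j = M i 0 * B 0 j + M i 1 * B 1 j.
Proof. by rewrite mxE big_ord_recl big_ord1 lift0_ord2. Qed.

Lemma det_mx2E (M : 'M[K]_2) : \det M = M 0 0 * M 1 1 - M 0 1 * M 1 0.
Proof.
rewrite (expand_det_row _ 0) big_ord_recl big_ord1 /cofactor !det_mx11.
rewrite !mxE lift0_ord2.
have -> : lift 1 0 = 0 :> 'I_2 by apply/val_inj.
by rewrite expr0 expr1; ring.
Qed.

Lemma vdetE v w : vdet v w = v 0 0 * w 1 0 - v 1 0 * w 0 0.
Proof. by rewrite /vdet det_mx2E !row_mx2_0 !row_mx2_1; ring. Qed.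

Lemma vdetZ a b v w : vdet (a *: v) (b *: w) = a * b * vdet v w.
Proof. by rewrite !vdetE !mxE; ring. Qed.

Lemma vdet_mulmx M v w : vdet (M *m v) (M *m w) = \det M * vdet v w.
Proof. by rewrite /vdet -mul_mx_row det_mulmx. Qed.

Lemma colmx2P v w : v 0 0 = w 0 0 -> v 1 0 = w 1 0 -> v = w.
Proof.
move=> e0 e1; by apply/colP => i; case: (ord2P i) => ->.
Qed.

Lemma vdet_cramer u v w : vdet v w *: u = vdet u w *: v + vdet v u *: w.
Proof. by apply: colmx2P; rewrite !mxE !vdetE; ring. Qed.

Lemma pdetE x y : pdet x y = vdet (pvec x) (pvec y).
Proof. by []. Qed.

Lemma pdet_eq0 x y : (pdet x y == 0) = (x == y).
Proof.
rewrite pdetE vdetE !mxE; case: x y => [a|] [b|] /=;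
  rewrite ?(mul1r, mulr1, mul0r, mulr0, subr0, sub0r, subrr) ?eqxx //.
- by rewrite subr_eq0.
- by rewrite oppr_eq0 oner_eq0.
- by rewrite oner_eq0.
Qed.

Lemma pdetC x y : pdet y x = - pdet x y.
Proof. by rewrite !pdetE !vdetE; ring. Qed.

(** The numerator and denominator of the cross ratio differ by this product. So for [x != y] and
    [z != t] the cross ratio is never 0/0 and never 1. *)
Lemma pdet_plucker x y z t :
  pdet x z * pdet y t - pdet x t * pdet y z = pdet x y * pdet z t.
Proof. by rewrite !pdetE !vdetE; ring. Qed.

Lemma pratioMl (k a b : K) : k != 0 -> pratio (k * a) (k * b) = pratio a b.
Proof.
move=> k0; rewrite /pratio mulf_eq0 (negPf k0) /=.
by case: eqP => // _; rewrite -mulf_div divff // mul1r.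
Qed.

Lemma pratio_pvec x : pratio (pvec x 0 0) (pvec x 1 0) = x.
Proof. by rewrite /pratio !mxE; case: x => [a|] /=; rewrite ?eqxx ?oner_eq0 ?divr1. Qed.

Lemma pratio_eq v x (s : K) : s != 0 -> v = s *: pvec x ->
  pratio (v 0 0) (v 1 0) = x.
Proof. by move=> s0 ->; rewrite ![fun_of_matrix (s *: _) _ _]mxE pratioMl // pratio_pvec. Qed.

Lemma pratioP v : v != 0 ->
  exists2 s, s != 0 & v = s *: pvec (pratio (v 0 0) (v 1 0)).
Proof.
move=> v0; rewrite /pratio; case: eqP => [v1|/eqP v1].
  exists (v 0 0).
    by apply: contraNneq v0 => v0; apply/eqP/colmx2P; rewrite ?v0 ?v1 !mxE.
  by apply: colmx2P; rewrite !mxE /= ?mulr1 // v1 mulr0.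
by exists (v 1 0) => //; apply: colmx2P; rewrite !mxE /= ?mulr1 // mulrC divfK.
Qed.

Lemma pvec_neq0 x : pvec x != 0.
Proof.
apply/eqP => /colP x0; case: x x0 => [a|] x0.
  by have /eqP := x0 1; rewrite !mxE oner_eq0.
by have /eqP := x0 0; rewrite !mxE oner_eq0.
Qed.

(** The action of [M] on PG(1, K), meaningful for invertible [M]: only then is the vector fed to
    [pratio] sure to be nonzero. *)
Definition mobius M x : option K :=
  pratio ((M *m pvec x) 0 0) ((M *m pvec x) 1 0).

Lemma mulmx_unit_neq0 m n (A : 'M[K]_m) (B : 'M[K]_(m, n)) :
  A \in unitmx -> (A *m B == 0) = (B == 0).
Proof.
move=> uA; apply/eqP/eqP => [AB0|->]; last by rewrite mulmx0.
by rewrite -(mulKmx uA B) AB0 mulmx0.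
Qed.

Lemma mobiusP M x : M \in unitmx ->
  exists2 s, s != 0 & M *m pvec x = s *: pvec (mobius M x).
Proof. by move=> uM; apply: pratioP; rewrite mulmx_unit_neq0 ?pvec_neq0. Qed.

Lemma mobius_eq M x y (s : K) : s != 0 -> M *m pvec x = s *: pvec y ->
  mobius M x = y.
Proof. exact: pratio_eq. Qed.

Lemma mobiusM M N x : N \in unitmx ->
  mobius (M *m N) x = mobius M (mobius N x).
Proof.
move=> uN; have [s s0 sE] := mobiusP x uN.
by rewrite {1}/mobius -mulmxA sE -scalemxAr ![fun_of_matrix (s *: _) _ _]mxE pratioMl.
Qed.

Lemma mobius1 x : mobius 1%:M x = x.
Proof. by apply: (@mobius_eq _ _ _ 1); rewrite ?oner_neq0 // mul1mx scale1r. Qed.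

Lemma mobiusK M : M \in unitmx -> cancel (mobius M) (mobius (invmx M)).
Proof. by move=> uM x; rewrite -mobiusM // mulVmx // mobius1. Qed.

Lemma mobiusVK M : M \in unitmx -> cancel (mobius (invmx M)) (mobius M).
Proof. by move=> uM x; rewrite -mobiusM ?unitmx_inv // mulmxV // mobius1. Qed.

Lemma mobius_inj M : M \in unitmx -> injective (mobius M).
Proof. by move=> uM; apply: can_inj (mobiusK uM). Qed.

(** Each bracket [pdet] is multiplied by [\det M], up to the scaling factors of its two points. Each
    of the four scaling factors occurs once in the numerator and once in the denominator, so
    everything cancels in [pratio]. *)
Lemma cross_ratio_mobius M x y z t : M \in unitmx ->
  cross_ratio (mobius M x) (mobius M y) (mobius M z) (mobius M t) =
  cross_ratio x y z t.
Proof.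
move=> uM; have [a a0 aE] := mobiusP x uM; have [b b0 bE] := mobiusP y uM.
have [c c0 cE] := mobiusP z uM; have [d d0 dE] := mobiusP t uM.
have dM0 : \det M != 0 by rewrite unitmxE unitfE in uM.
have E e f p q r s : M *m pvec p = e *: pvec r -> M *m pvec q = f *: pvec s ->
    \det M * pdet p q = e * f * pdet r s.
  by move=> pE qE; rewrite !pdetE -vdet_mulmx pE qE vdetZ.
have k0 : \det M * \det M != 0 by rewrite mulf_neq0.
have l0 : a * b * c * d != 0 by rewrite !mulf_neq0.
rewrite /cross_ratio -[in RHS](pratioMl _ _ k0) -[in LHS](pratioMl _ _ l0).
have split2 (k m n : K) : k * k * (m * n) = (k * m) * (k * n) by ring.
rewrite !split2 (E _ _ _ _ _ _ aE cE) (E _ _ _ _ _ _ bE dE).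
rewrite (E _ _ _ _ _ _ aE dE) (E _ _ _ _ _ _ bE cE); congr pratio; ring.
Qed.

(** The hypothesis excludes 0/0, which [pratio] sends to infinity in both orders. *)
Lemma pratio_swap (a b : K) : a != b -> pinv (pratio a b) = pratio b a.
Proof.
move=> ab; rewrite /pinv /pratio; case: (eqVneq b 0) => [b0|b0].
  by rewrite b0 mul0r ifN // -b0.
have [a0|a0] := eqVneq a 0; first by rewrite a0 mul0r eqxx.
by rewrite mulf_eq0 invr_eq0 (negPf a0) (negPf b0) /= div1r invf_div.
Qed.

Lemma pinvK : involutive (@pinv K).
Proof.
case=> [a|]; rewrite /= /pratio ?eqxx //; case: eqP => [->//|/eqP a0] /=.
by rewrite /pratio div1r invr_eq0 (negPf a0) div1r invrK.
Qed.

Lemma cross_ratio_neq x y z t : x != y -> z != t ->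
  pdet x z * pdet y t != pdet x t * pdet y z.
Proof. by move=> xy zt; rewrite -subr_eq0 pdet_plucker mulf_neq0 ?pdet_eq0. Qed.

Lemma cross_ratio_swapr x y z t : x != y -> z != t ->
  cross_ratio x y t z = pinv (cross_ratio x y z t).
Proof. by move=> xy zt; rewrite /cross_ratio pratio_swap // cross_ratio_neq. Qed.

Lemma cross_ratio_swap2 x y z t : cross_ratio y x t z = cross_ratio x y z t.
Proof. by rewrite /cross_ratio; congr pratio; rewrite mulrC. Qed.

Lemma cross_ratio_swapl x y z t : x != y -> z != t ->
  cross_ratio y x z t = pinv (cross_ratio x y z t).
Proof. by move=> xy zt; rewrite cross_ratio_swap2 cross_ratio_swapr. Qed.

(** Every bracket changes sign, and the signs cancel in pairs. This is the source of the symmetry of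
    the orbitals. *)
Lemma cross_ratioC x y z t : cross_ratio z t x y = cross_ratio x y z t.
Proof.
by rewrite /cross_ratio; congr pratio; rewrite !(pdetC _ x) !(pdetC _ y); ring.
Qed.

Lemma cross_ratio_neq1 x y z t : x != y -> z != t ->
  cross_ratio x y z t != Some 1.
Proof.
move=> xy zt; have := cross_ratio_neq xy zt; apply: contra => /eqP.
rewrite /cross_ratio /pratio; case: eqP => // /eqP d0 [/(canRL (divfK d0))->].
by rewrite mul1r.
Qed.

(* The cross ratio is a projective coordinate of its last argument.           *)
Lemma cross_ratio_inj x y z t t' : x != y -> x != z -> y != z ->
  cross_ratio x y z t = cross_ratio x y z t' -> t = t'.
Proof.
move=> xy xz yz; have nz s : vdet (pvec x) (pvec z) * pdet y s = 0 ->
    pdet x s * pdet y z = 0 -> False.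
  move/eqP; rewrite mulf_eq0 !pdet_eq0 (negPf xz) => /= /eqP <-.
  by move/eqP; rewrite mulf_eq0 !pdet_eq0 (negPf xy) (negPf yz).
have E a b c d : (a = 0 -> b = 0 -> False) -> (c = 0 -> d = 0 -> False) ->
    pratio a b = pratio c d -> a * d = b * c :> K.
  rewrite /pratio => ab cd; case: eqP => [b0|/eqP b0]; case: eqP => [d0|/eqP d0] //.
    by rewrite b0 d0 mulr0 mul0r.
  by case=> /(canRL (divfK b0)) ->; rewrite mulrAC divfK // mulrC.
move/(E _ _ _ _ (@nz t) (@nz t')); rewrite -!pdetE => e.
apply/eqP; rewrite -pdet_eq0.
have : pdet x z * pdet y z * pdet x y * pdet t t' = 0.
  have -> : pdet x z * pdet y z * pdet x y * pdet t t' =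
     pdet x t * pdet y z * (pdet x z * pdet y t') -
     pdet x z * pdet y t * (pdet x t' * pdet y z).
    by rewrite -mulrA -(pdet_plucker x y t t'); ring.
  by rewrite e; ring.
by move/eqP; rewrite !mulf_eq0 !pdet_eq0 (negPf xz) (negPf yz) (negPf xy).
Qed.

Lemma unitmx_vdet v w : (row_mx v w : 'M_2) \in unitmx = (vdet v w != 0).
Proof. by rewrite unitmxE unitfE. Qed.

Lemma mulmx_pvec0 v w x : (row_mx v w : 'M_2) *m pvec x =
   pvec x 0 0 *: v + pvec x 1 0 *: w.
Proof.
by apply: colmx2P; rewrite mulmx2E row_mx2_0 row_mx2_1 !mxE /=; ring.
Qed.

Lemma mobius_3transitive x y z : x != y -> x != z -> y != z ->
  exists2 M, M \in unitmx &
    [/\ mobius M None = x, mobius M (Some 0) = y & mobius M (Some 1) = z].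
Proof.
move=> xy xz yz.
have zy : z != y by rewrite eq_sym.
(* The columns are multiples of [pvec x] and [pvec y], so infinity goes to [x] and 0 to [y]. The
   coefficients are those of Cramer's rule, which makes the sum of the columns [pdet x y *: pvec z],
   so 1 goes to [z]. *)
exists (row_mx (pdet z y *: pvec x) (pdet x z *: pvec y) : 'M_2).
  by rewrite unitmx_vdet vdetZ !mulf_neq0 // -?pdetE pdet_eq0.
split.
- apply: (@mobius_eq _ _ _ (pdet z y)); rewrite ?pdet_eq0 // mulmx_pvec0 !mxE /=.
  by rewrite scale1r scale0r addr0.
- apply: (@mobius_eq _ _ _ (pdet x z)); rewrite ?pdet_eq0 // mulmx_pvec0 !mxE /=.
  by rewrite scale1r scale0r add0r.
- apply: (@mobius_eq _ _ _ (pdet x y)); rewrite ?pdet_eq0 // mulmx_pvec0 !mxE /=.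
  by rewrite !scale1r !pdetE -vdet_cramer.
Qed.

Lemma mobius_3transitive2 x y z x' y' z' :
  x != y -> x != z -> y != z -> x' != y' -> x' != z' -> y' != z' ->
  exists2 M, M \in unitmx &
    [/\ mobius M x = x', mobius M y = y' & mobius M z = z'].
Proof.
move=> xy xz yz xy' xz' yz'.
have [M uM [<- <- <-]] := mobius_3transitive xy xz yz.
have [N uN [<- <- <-]] := mobius_3transitive xy' xz' yz'.
exists (N *m invmx M); first by rewrite unitmx_mul uN unitmx_inv.
by rewrite !mobiusM ?unitmx_inv // !mobiusK.
Qed.

Lemma mobius_fix3 M : M \in unitmx -> mobius M None = None ->
  mobius M (Some 0) = Some 0 -> mobius M (Some 1) = Some 1 ->
  exists2 c, c != 0 & M = c%:M.
Proof.
move=> uM.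
have [a a0 aE] := mobiusP None uM; have [b b0 bE] := mobiusP (Some 0) uM.
have [c c0 cE] := mobiusP (Some 1) uM => e1 e2 e3.
move: aE bE cE; rewrite {}e1 {}e2 {}e3 => /colP aE /colP bE /colP cE.
exists c => //.
have M10 : M 1 0 = 0.
  by have := aE 1; rewrite mulmx2E !mxE /= mulr1 !mulr0 addr0.
have M01 : M 0 1 = 0.
  by have := bE 0; rewrite mulmx2E !mxE /= mulr1 !mulr0 add0r.
have M00 : M 0 0 = c by have := cE 0; rewrite mulmx2E !mxE /= !mulr1 M01 addr0.
have M11 : M 1 1 = c by have := cE 1; rewrite mulmx2E !mxE /= !mulr1 M10 add0r.
apply/matrixP => i j.
by case: (ord2P i) => ->; case: (ord2P j) => ->;
  rewrite !mxE ?M00 ?M01 ?M10 ?M11 ?mulr1n ?mulr0n.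
Qed.

(** With [A] taking infinity, 0, 1 to the three points, the conjugate by [A] of $M^{-1}N$ fixes
    infinity, 0 and 1, hence is scalar by [mobius_fix3]. *)
Lemma mobius_unique M N x y z : M \in unitmx -> N \in unitmx ->
  x != y -> x != z -> y != z ->
  mobius M x = mobius N x -> mobius M y = mobius N y ->
  mobius M z = mobius N z -> exists2 c, c != 0 & N = c *: M.
Proof.
move=> uM uN xy xz yz.
have [A uA [<- <- <-]] := mobius_3transitive xy xz yz => e1 e2 e3.
pose B := invmx A *m (invmx M *m (N *m A)).
have uB : B \in unitmx by rewrite !unitmx_mul !unitmx_inv uM uN uA.
have BE t : mobius M (mobius A t) = mobius N (mobius A t) -> mobius B t = t.
  move=> e; rewrite /B !mobiusM ?unitmx_mul ?unitmx_inv ?uM ?uN ?uA //.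
  by rewrite -e !mobiusK.
have [c c0 cE] := mobius_fix3 uB (BE _ e1) (BE _ e2) (BE _ e3).
exists c => //; have : A *m B = A *m c%:M by rewrite cE.
rewrite /B mulKVmx // scalar_mxC => /(canRL (mulKVmx uM)).
rewrite mulmxA => /(can_inj (mulmxK uA)) ->.
by rewrite scalar_mxC mul_scalar_mx.
Qed.

End ProjectiveLine.

(** * The conic and its lines *)

Section Conic.

Variable K : finFieldType.
Implicit Types (x y : option K) (v w : 'cV[K]_2) (A : 'M[K]_2) (u : 'rV[K]_3).
Implicit Types (M : 'M[K]_3) (s : 'cV[K]_3).

Lemma pclassP m n (B C : 'M[K]_(m, n)) :
  reflect (exists2 a, a != 0 & C = a *: B) (C \in pclass B).
Proof.
apply: (iffP imsetP) => -[a a0 ->]; exists a => //; first by rewrite inE in a0.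
by rewrite inE.
Qed.

Lemma pclass_refl m n (B : 'M[K]_(m, n)) : B \in pclass B.
Proof. by apply/pclassP; exists 1; rewrite ?oner_neq0 ?scale1r. Qed.

Lemma pclassZ m n (a : K) (B : 'M[K]_(m, n)) : a != 0 -> pclass (a *: B) = pclass B.
Proof.
move=> a0; apply/setP => C; apply/pclassP/pclassP => -[b b0 ->].
  by exists (b * a); rewrite ?mulf_neq0 // scalerA.
by exists (b / a); rewrite ?mulf_neq0 ?invr_eq0 // scalerA divfK.
Qed.

Lemma pclass_eqP m n (B C : 'M[K]_(m, n)) :
  reflect (exists2 a, a != 0 & C = a *: B) (pclass B == pclass C).
Proof.
apply: (iffP eqP) => [BC|[a a0 ->]]; last by rewrite pclassZ.
by apply/pclassP; rewrite BC pclass_refl.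
Qed.

Lemma act_point_pclass M s : act_point (pclass M) (pclass s) = pclass (M *m s).
Proof.
apply/setP => t; apply/imset2P/pclassP.
  case=> _ _ /pclassP[a a0 ->] /pclassP[b b0 ->] ->.
  by exists (a * b); rewrite ?mulf_neq0 // -scalemxAl -scalemxAr scalerA.
case=> a a0 ->; exists (a *: M) s; last by rewrite scalemxAl.
  by apply/pclassP; exists a.
exact: pclass_refl.
Qed.

Lemma mem_line u s : s != 0 -> (pclass s \in line u) = (u *m s == 0).
Proof.
move=> s0; apply/imsetP/idP => [[t]|us0]; last by exists s; rewrite // inE s0.
rewrite inE => /andP[t0 ut0] /eqP/pclass_eqP[a a0 tE].
move: ut0; rewrite tE -scalemxAr => /eqP/(congr1 (fun B => a^-1 *: B)).
by rewrite scalerA mulVf // scale1r scaler0 => ->.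
Qed.

Lemma lineP u P : reflect (exists s, [/\ s != 0, u *m s = 0 & P = pclass s])
  (P \in line u).
Proof.
apply: (iffP imsetP) => [[s]|[s [s0 us0 ->]]].
  by rewrite inE => /andP[s0 /eqP us0] ->; exists s.
by exists s; rewrite // inE s0 us0 eqxx.
Qed.

(** Each nonzero column of [cokermx u'] represents a point of [line u'], hence of [line u]. So [u]
    kills the cokernel of [u'] and lies in its row space. *)
Lemma line_inj u u' : u != 0 -> line u = line u' ->
  exists2 a, a != 0 & u = a *: u'.
Proof.
move=> u0 uu'.
suff /sub_rVP[a uE] : (u <= u')%MS.
  by exists a => //; apply: contraNneq u0 => a0; rewrite uE a0 scale0r.
rewrite submxE; apply/eqP/matrixP => i j; rewrite (ord1 i) {i} [RHS]mxE.
have colE (t : 'rV[K]_3) (B : 'M_3) : (t *m B) 0 j = (t *m col j B) 0 0.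
  by rewrite !mxE; apply: eq_bigr => k _; rewrite mxE.
rewrite colE; have [->|c0] := eqVneq (col j (cokermx u')) 0.
  by rewrite mulmx0 mxE.
have : pclass (col j (cokermx u')) \in line u'.
  rewrite mem_line //; apply/eqP/matrixP => a b.
  by rewrite (ord1 a) (ord1 b) -colE mulmx_coker !mxE.
by rewrite -uu' mem_line // => /eqP ->; rewrite mxE.
Qed.

Lemma act_line_line M u : M \in unitmx ->
  act_line (pclass M) (line u) = line (u *m invmx M).
Proof.
move=> uM; apply/setP => P; apply/imsetP/lineP.
  case=> _ /lineP[s [s0 us0 ->]] ->; exists (M *m s); split.
  - by rewrite mulmx_unit_neq0.
  - by rewrite mulmxA mulmxKV.
  - exact: act_point_pclass.
case=> s [s0 us0 ->]; exists (pclass (invmx M *m s)).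
  apply/lineP; exists (invmx M *m s); split=> //; last by rewrite mulmxA.
  by rewrite mulmx_unit_neq0 ?unitmx_inv.
by rewrite act_point_pclass mulKVmx.
Qed.

(** The homogeneous form of the parametrisation of the conic: (s, t) goes to (st, s^2, t^2). *)
Definition veronese v : 'cV[K]_3 :=
  \col_(i < 3) [:: v 0 0 * v 1 0; v 0 0 ^+ 2; v 1 0 ^+ 2]`_i.

Lemma veroneseZ (a : K) v : veronese (a *: v) = a ^+ 2 *: veronese v.
Proof.
by apply/colP => -[[|[|[|]]]] //= i; rewrite !mxE /=; ring.
Qed.

Lemma veronese_neq0 v : v != 0 -> veronese v != 0.
Proof.
apply: contraNneq => /colP v0; have := v0 1; have := v0 (inord 2).
rewrite !mxE /= inordK //= => /eqP; rewrite expf_eq0 /= => /eqP v1.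
by move=> /eqP; rewrite expf_eq0 /= => /eqP v2; apply/eqP/colmx2P; rewrite mxE.
Qed.

Lemma conic_pointE x : conic_point x = pclass (veronese (pvec x)).
Proof.
congr pclass; apply/colP => i; rewrite !mxE; case: x => [a|];
 by case: i => [[|[|[|]]]] //= i; ring.
Qed.

Lemma mem_conic u x :
  (conic_point x \in line u) = (u *m veronese (pvec x) == 0).
Proof. by rewrite conic_pointE mem_line ?veronese_neq0 ?pvec_neq0. Qed.

(** The rows of [conic_mx A] list the coefficients, in the monomials st, s^2, t^2, of the product
    and the squares of the coordinates of [A *m v]. *)
Lemma conic_mx_veronese A v : conic_mx A *m veronese v = veronese (A *m v).
Proof.
apply/colP => i; rewrite /conic_mx /veronese !(mulmx2E A v) mxE.
rewrite !big_ord_recl big_ord0 !mxE.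
by case: i => [[|[|[|]]]] //= i; ring.
Qed.

Lemma conic_mxM A A' : conic_mx (A *m A') = conic_mx A *m conic_mx A'.
Proof.
apply/matrixP => i j; rewrite [RHS]mxE !big_ord_recl big_ord0.
rewrite /conic_mx !(mulmx2E A A') !mxE /=.
case: i => [[|[|[|]]]] //= i; case: j => [[|[|[|]]]] //= j; ring.
Qed.

Lemma conic_mx1 : conic_mx (1%:M : 'M[K]_2) = 1%:M.
Proof.
apply/matrixP => i j; rewrite !mxE /=.
case: i => [[|[|[|]]]] //= i; case: j => [[|[|[|]]]] //= j; ring.
Qed.

Lemma conic_mx_unit A : A \in unitmx -> conic_mx A \in unitmx.
Proof.
move=> uA; have := mulmx1_unit (_ : conic_mx A *m conic_mx (invmx A) = 1%:M).
by case=> //; rewrite -conic_mxM mulmxV // conic_mx1.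
Qed.

Lemma conic_point_inj : injective (@conic_point K).
Proof.
move=> x y; rewrite !conic_pointE => /eqP/pclass_eqP[a a0 /colP e].
have := e 0; have := e 1; have := e (inord 2); rewrite !mxE inordK //=.
case: x y {e} => [x|] [y|] //=.
- by rewrite !expr1n !mulr1 => <- _; rewrite !mul1r => ->.
- by rewrite expr1n expr0n mulr1 => /esym/eqP; rewrite (negPf a0).
- by rewrite expr1n expr0n /= mulr0 => /eqP; rewrite oner_eq0.
Qed.

(** The linear form [u] evaluated at [veronese v]. A line thus becomes a binary quadratic form, and
    its points on the conic become roots in PG(1, K). *)
Definition quad u v : K :=
  u 0 0 * (v 0 0 * v 1 0) + u 0 1 * v 0 0 ^+ 2 + u 0 (inord 2) * v 1 0 ^+ 2.

Lemma mul_veronese u v : (u *m veronese v == 0) = (quad u v == 0).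
Proof.
have -> : u *m veronese v = (quad u v)%:M.
  apply/matrixP => i j; rewrite (ord1 i) (ord1 j) !mxE eqxx mulr1n.
  rewrite !big_ord_recl big_ord0 !mxE /= addr0 addrA /quad.
  by do ?[congr (_ + _)]; congr (u 0 _ * _); apply/val_inj; rewrite /= ?inordK.
by rewrite -scalemx1 scaler_eq0 oner_eq0 orbF.
Qed.

Definition quad_roots u : {set option K} := [set x | quad u (pvec x) == 0].

Lemma quad_rootsE u : quad_roots u = [set x | conic_point x \in line u].
Proof. by apply/setP => x; rewrite !inE mem_conic mul_veronese. Qed.

(* The coefficients of the quadratic form [vdet v x * vdet v y]. *)
Definition chord x y : 'rV[K]_3 :=
  let a := pvec x in let b := pvec y in
  \row_(i < 3) [:: - (a 1 0 * b 0 0 + a 0 0 * b 1 0);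
                   a 1 0 * b 1 0; a 0 0 * b 0 0]`_i.

Lemma quad_chord x y v : quad (chord x y) v = vdet v (pvec x) * vdet v (pvec y).
Proof. by rewrite /quad !vdetE !mxE inordK //=; ring. Qed.

Lemma quad_roots_chord x y : quad_roots (chord x y) = [set x; y].
Proof.
by apply/setP => z; rewrite !inE quad_chord mulf_eq0 -!pdetE !pdet_eq0.
Qed.

(** The zero form would vanish at infinity, 0 and 1, whereas this form has at most two roots. *)
Lemma chord_neq0 x y : chord x y != 0.
Proof.
apply/eqP => xy0.
have quad0 z : z \in quad_roots (chord x y) by rewrite xy0 inE /quad !mxE !mul0r !addr0.
have : [set None; Some 0; Some 1] \subset [set x; y].
  by apply/subsetP => z _; rewrite -quad_roots_chord.
move/subset_leq_card; rewrite cards2 setUC cardsU1 !inE cards2 /=.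
by rewrite (inj_eq Some_inj) oner_eq0; case: (x == y).
Qed.

(** Two distinct roots determine a binary quadratic form up to a scalar, which may vanish here since
    [u] may be 0. *)
Lemma quad_roots_two u x y : x != y -> x \in quad_roots u -> y \in quad_roots u ->
  exists a, u = a *: chord x y.
Proof.
have ext (t t' : 'rV[K]_3) : t 0 0 = t' 0 0 -> t 0 1 = t' 0 1 ->
    t 0 (inord 2) = t' 0 (inord 2) -> t = t'.
  move=> e0 e1 e2; apply/rowP => -[[|[|[|]]]] //= i.
  - by have -> : Ordinal i = 0 by apply/val_inj.
  - by have -> : Ordinal i = 1 by apply/val_inj.
  - by have -> : Ordinal i = inord 2 by apply/val_inj; rewrite /= inordK.
rewrite !inE /quad !mxE; case: x y => [x|] [y|] //= xy;
  rewrite ?(mulr0, mulr1, mul0r, mul1r, add0r, addr0, expr0n, expr1n) /=.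
(* For finite roots the chord has leading coefficient 1. Subtracting the two root equations and
   cancelling [x - y] gives Vieta's formula for the sum of the roots. *)
- rewrite (inj_eq Some_inj) -subr_eq0 in xy => /eqP ex /eqP ey; exists (u 0 1).
  have e : u 0 0 + u 0 1 * (x + y) = 0.
    by apply: (mulfI xy); rewrite mulr0 -[RHS](subrr 0) -{1}ex -ey; ring.
  have e' : u 0 0 = - (u 0 1 * (x + y)) by apply/eqP; rewrite -addr_eq0 e.
  apply: ext; rewrite !mxE ?inordK //=; rewrite ?e'; first by ring.
    by ring.
  by apply/eqP; rewrite -subr_eq0 -ex e'; apply/eqP; ring.
(* A root at infinity kills the coefficient [u 0 1], so the scalar is read off the middle
   coefficient, which is -1 in the chord. *)
- move=> /eqP ex /eqP ey; exists (- u 0 0).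
  apply: ext; rewrite !mxE ?inordK //= ?ey; first by ring.
    by ring.
  by apply/eqP; rewrite -subr_eq0 -ex ey; apply/eqP; ring.
- move=> /eqP ex /eqP ey; exists (- u 0 0).
  apply: ext; rewrite !mxE ?inordK //= ?ex; first by ring.
    by ring.
  by apply/eqP; rewrite -subr_eq0 -ey ex; apply/eqP; ring.
Qed.

Lemma quad_roots_act A u : A \in unitmx ->
  quad_roots (u *m invmx (conic_mx A)) = mobius A @: quad_roots u.
Proof.
move=> uA; apply/setP => x; rewrite -(mobiusVK uA x) mem_imset; last exact: mobius_inj.
set y := mobius _ x; have [s s0 sE] := mobiusP y uA.
rewrite !inE -!mul_veronese.
have -> : u *m veronese (pvec y) =
    s ^+ 2 *: (u *m invmx (conic_mx A) *m veronese (pvec (mobius A y))).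
  by rewrite scalemxAr -veroneseZ -sE -conic_mx_veronese mulmxA mulmxKV ?conic_mx_unit.
by rewrite scaler_eq0 expf_eq0 (negPf s0).
Qed.

Lemma act_lineM M N u : M \in unitmx -> N \in unitmx ->
  act_line (pclass (M *m N)) (line u) =
  act_line (pclass M) (act_line (pclass N) (line u)).
Proof.
move=> uM uN; rewrite !act_line_line ?unitmx_mul ?uM //.
congr line; rewrite -mulmxA; congr (_ *m _).
have uMN : M *m N \in unitmx by rewrite unitmx_mul uM.
by apply: (can_inj (mulKmx uMN)); rewrite mulmxV // mulmxA mulmxK // mulmxV.
Qed.

Lemma act_line1 u : act_line (pclass 1%:M) (line u) = line u.
Proof. by rewrite act_line_line ?unitmx1 // invmx1 mulmx1. Qed.

Lemma linesP (l : {set point K}) :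
  reflect (exists2 u, u != 0 & l = line u) (l \in lines K).
Proof.
apply: (iffP imsetP) => -[u u0 ->]; exists u => //; first by rewrite inE in u0.
by rewrite inE.
Qed.

Lemma act_lines A l : A \in unitmx -> l \in lines K ->
  act_line (pclass (conic_mx A)) l \in lines K.
Proof.
move=> uA /linesP[u u0 ->]; rewrite act_line_line ?conic_mx_unit //.
apply/linesP; exists (u *m invmx (conic_mx A)) => //.
apply: contraNneq u0 => e; rewrite -(mulmxKV (conic_mx_unit uA) u) e mul0mx //.
Qed.

Lemma conic_groupP g :
  reflect (exists2 A, A \in unitmx & g = pclass (conic_mx A)) (g \in conic_group K).
Proof.
apply: (iffP imsetP) => -[A uA ->]; exists A => //; first by rewrite inE in uA.
by rewrite inE.
Qed.

Lemma conic_group_acts_on_lines : acts_as_group (conic_group K) (@act_line K) (lines K).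
Proof.
split.
- by move=> g l /conic_groupP[A uA ->] Ll; apply: act_lines.
- exists (pclass 1%:M); last by move=> _ /linesP[u _ ->]; apply: act_line1.
  by apply/conic_groupP; exists 1%:M; rewrite ?unitmx1 // conic_mx1.
- move=> _ _ /conic_groupP[A uA ->] /conic_groupP[B uB ->].
  exists (pclass (conic_mx (A *m B))).
    by apply/conic_groupP; exists (A *m B); rewrite // unitmx_mul uA.
  by move=> _ /linesP[u _ ->]; rewrite conic_mxM act_lineM ?conic_mx_unit.
- move=> _ /conic_groupP[A uA ->].
  exists (pclass (conic_mx (invmx A))).
    by apply/conic_groupP; exists (invmx A); rewrite // unitmx_inv.
  move=> _ /linesP[u _ ->]; rewrite -act_lineM ?conic_mx_unit ?unitmx_inv //.
  by rewrite -conic_mxM mulVmx // conic_mx1 act_line1.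
Qed.

Lemma card_line_conic u : #|line u :&: conic K| = #|quad_roots u|.
Proof.
rewrite quad_rootsE -(card_imset _ conic_point_inj); apply: eq_card => P.
apply/setIP/imsetP => [[uP /imsetP[x _ PE]]|[x]].
  by exists x; rewrite // inE -PE.
by rewrite inE => ux ->; rewrite imset_f.
Qed.

End Conic.

(** * The quadratic extension *)

Lemma pFrobenius_power_rmorphism (R : comNzRingType) (p n : nat) :
  p \in [pchar R] ->
  exists s : {rmorphism R -> R}, forall x, s x = x ^+ (p ^ n).
Proof.
move=> chR; elim: n => [|n [s sE]]; first by exists idfun => x; rewrite expn0 expr1.
exists (pFrobenius_aut chR \o s) => x /=.
by rewrite pFrobenius_autE sE -exprM expnSr.
Qed.

(** $X^{|K|} - X$ is the product of all $X - x$, so a nonconstant divisor contains one of these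
    factors. Both the norm equation and the quadratic equations are solved in [K] this way. *)
Lemma dvdp_genPoly_root (K : finFieldType) (p : {poly K}) :
  (1 < size p)%N -> p %| 'X^#|K| - 'X -> exists x, root p x.
Proof.
move=> p1; rewrite finField_genPoly -big_enum => /dvdp_prod_XsubC[m pE].
case E: (mask m (enum K)) pE => [|x s] pE.
  by move: p1; rewrite (eqp_size pE) big_nil size_poly1.
by exists x; rewrite (eqp_root pE) root_prod_XsubC inE eqxx.
Qed.

(** The quotient of F[X] by [h] is a field with $|F|^{\deg h}$ elements, and the class of X is fixed
    by raising to that power. *)
Lemma irreducible_dvdp_genPoly (F : finFieldType) (h : {poly F}) :
  irreducible_poly h -> h \is monic -> h %| 'X^(#|F| ^ (size h).-1) - 'X.
Proof.
move=> hI hm; pose mi : monic_irreducible_poly h := (hI, hm).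
set N := (#|F| ^ _)%N.
have XN : in_qpoly h 'X ^+ N = in_qpoly h 'X.
  have := expf_card (in_qpoly h 'X : {poly %/ h with mi}).
  by rewrite card_qfpoly.
have : in_qpoly h ('X^N - 'X) = 0 by rewrite rmorphB rmorphXn /= XN subrr.
move/(congr1 val) => /=; rewrite (mk_monicE mi) => h0.
by rewrite /dvdp Pdiv.IdomainMonic.modpE // h0.
Qed.

Section QuadraticExtension.

Variables (q : nat) (F K : finFieldType) (iota : {rmorphism F -> K}).
Hypotheses (hq : prime_power q) (hF : #|F| = q) (hK : #|K| = (q ^ 2)%N).

Lemma q_gt1 : (1 < q)%N.
Proof. by rewrite -hF; apply: finNzRing_gt1. Qed.

Lemma exists_conjugation : exists s : {rmorphism K -> K}, forall x, s x = x ^+ q.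
Proof.
have [p [n [p_pr n0 qE]]] := hq; rewrite qE.
apply: pFrobenius_power_rmorphism; apply: (card_finPcharP (n := (n * 2)%N)) => //.
by rewrite hK qE expnM.
Qed.

(** The polynomial $X^q - X$ already splits over [F], so all its roots in [K] come from [F]. *)
Lemma fixed_conjugation x : x ^+ q = x -> exists a, x = iota a.
Proof.
move=> xq; have : (map_poly iota ('X^#|F| - 'X)).[x] == 0.
  by rewrite rmorphB /= map_polyXn map_polyX !hornerE hF xq subrr.
rewrite finField_genPoly rmorph_prod horner_prod => /prodf_eq0[a _].
rewrite /= rmorphB /= map_polyX map_polyC !hornerE subr_eq0 => /eqP->.
by exists a.
Qed.

(** Since $l^{q-1} = 1$ and $(q+1)(q-1) = q^2-1$, the polynomial $X^{q+1} - l$ divides $X^{q^2} - X$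
    and has a root in [K]. *)
Lemma norm_surjective (l : F) : l != 0 -> exists t, t ^+ q.+1 = iota l.
Proof.
move=> l0; have q1 := q_gt1; pose p : {poly K} := 'X^(q.+1) - (iota l)%:P.
have [||t] := @dvdp_genPoly_root K p; first by rewrite size_XnsubC.
  have -> : 'X^#|K| - 'X = 'X * ('X^(q.+1) ^+ q.-1 - (iota l)%:P ^+ q.-1) :> {poly K}.
    have -> : (iota l)%:P ^+ q.-1 = 1.
      rewrite -rmorphXn /= -rmorphXn /=; have /(congr1 (fun a => l^-1 * a)) := expf_card l.
      rewrite hF -[in l ^+ q](prednK (ltnW q1)) exprS mulKf // mulVf // => ->.
      by rewrite rmorph1.
    rewrite -exprM mulrBr mulr1 -exprS; congr ('X^_ - _); rewrite hK; nia.
  by rewrite dvdp_mull // subrXX dvdp_mulr.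
by rewrite rootE !hornerE subr_eq0 => /eqP; exists t.
Qed.

Lemma exists_nonfixed : exists x : K, x ^+ q != x.
Proof.
have [/existsP//|] := boolP [exists x : K, x ^+ q != x].
rewrite negb_exists => /forallP allK.
have q1 := q_gt1.
have : (#|K| <= #|iota @: [set: F]|)%N.
  apply/subset_leq_card/subsetP => x _.
  have /negPn/eqP/fixed_conjugation[a ->] := allK x.
  by apply: imset_f; rewrite inE.
rewrite hK => h; have := leq_trans h (leq_imset_card _ _).
by rewrite cardsT hF; nia.
Qed.

Lemma odd_card_field : odd q = (1 != - 1 :> F).
Proof.
have [p [n [p_pr n0 qE]]] := hq.
have chF : p \in [pchar F] by apply: (card_finPcharP (n := n)); rewrite // hF.
rewrite -subr_eq0 opprK -mulr2n -(dvdn_pcharf chF) qE oddX eqn0Ngt n0 /=.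
rewrite (dvdn_prime2 p_pr) //; case: (even_prime p_pr) => [->//|p_odd].
by rewrite p_odd; apply/esym; apply: contraTneq p_odd => ->.
Qed.

(** A quadratic without roots over [F] is irreducible, hence divides $X^{q^2} - X$, which splits
    over [K]. *)
Lemma exists_root_over_quadratic (u : 'rV[F]_3) :
  quad_roots u = set0 -> exists x, x \in quad_roots (map_mx iota u).
Proof.
move=> u0; have rootF x : quad u (pvec x) != 0.
  by have /setP/(_ x) := u0; rewrite !inE => ->.
(* Infinity is not a root either, so the form has degree exactly 2 and can be made monic. *)
have u1 : u 0 1 != 0.
  apply: contraNneq (rootF None) => u1.
  by rewrite /quad !mxE /= u1 expr0n /= !mulr0 mul0r !addr0.
pose b := u 0 0 / u 0 1; pose c := u 0 (inord 2) / u 0 1.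
pose h : {poly F} := 'X^2 + (b *: 'X + c%:P).
have szl : (size (b *: 'X + c%:P)%R < size ('X^2 : {poly F})%R)%N.
  rewrite size_polyXn; apply: leq_ltn_trans (size_polyD _ _) _.
  by rewrite gtn_max (leq_ltn_trans (size_scale_leq _ _)) ?size_polyX //
     (leq_ltn_trans (size_polyC_leq1 _)).
have szh : size h = 3 by rewrite size_polyDl // size_polyXn.
have hm : h \is monic by rewrite monicE lead_coefDl // lead_coefXn.
have quadE (R : comRingType) (x a b' c' : R) :
  b' * x + a * x ^+ 2 + c' = b' * (x * 1) + a * x ^+ 2 + c' * 1 ^+ 2 by ring.
have hI : irreducible_poly h.
  apply: cubic_irreducible; first by rewrite szh.
  move=> x; apply: contra (rootF (Some x)); rewrite rootE !hornerE => /eqP e.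
  rewrite /quad !mxE /= -quadE.
  have -> : u 0 0 * x + u 0 1 * x ^+ 2 + u 0 (inord 2) =
    u 0 1 * (x ^+ 2 + b * x + c) by rewrite /b /c; field.
  by rewrite e mulr0.
have [||x] := @dvdp_genPoly_root K (map_poly iota h).
- by rewrite size_map_poly szh.
- have := irreducible_dvdp_genPoly hI hm.
  rewrite -(dvdp_map iota) rmorphB /= map_polyXn map_polyX.
  by rewrite szh hF hK.
move=> rx; exists (Some x); rewrite inE /quad !mxE /= -quadE.
have -> : iota (u 0 0) * x + iota (u 0 1) * x ^+ 2 + iota (u 0 (inord 2)) =
    iota (u 0 1) * (x ^+ 2 + iota b * x + iota c).
  by rewrite /b /c !fmorph_div; field; rewrite fmorph_eq0.
move: rx; rewrite rootE rmorphD /= map_polyXn rmorphD /= map_polyZ map_polyX.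
by rewrite map_polyC => rx; move: rx; rewrite !hornerE => /eqP e; rewrite [X in _ * X]e mulr0.
Qed.

End QuadraticExtension.

(** * Non-tangent lines as pairs of points *)

Section BaseChange.

Variables (E K : finFieldType) (f : {rmorphism E -> K}).

Lemma map_pvec (x : option E) : map_mx f (pvec x) = pvec (omap f x).
Proof.
by apply: colmx2P; rewrite !mxE; case: x => [a|] //=; rewrite ?rmorph0 ?rmorph1.
Qed.

Lemma map_pdet (x y : option E) : pdet (omap f x) (omap f y) = f (pdet x y).
Proof. by rewrite !pdetE !vdetE -!map_pvec !mxE rmorphB !rmorphM. Qed.

Lemma map_pratio (a b : E) : pratio (f a) (f b) = omap f (pratio a b).
Proof. by rewrite /pratio fmorph_eq0; case: eqP => //= _; rewrite fmorph_div. Qed.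

Lemma map_pinv (x : option E) : pinv (omap f x) = omap f (pinv x).
Proof. by case: x => [a|] /=; rewrite ?rmorph0 // -map_pratio rmorph1. Qed.

Lemma map_cross_ratio (x y z t : option E) :
  cross_ratio (omap f x) (omap f y) (omap f z) (omap f t) =
  omap f (cross_ratio x y z t).
Proof. by rewrite /cross_ratio !map_pdet -!rmorphM map_pratio. Qed.

Lemma map_mobius (M : 'M[E]_2) (x : option E) :
  mobius (map_mx f M) (omap f x) = omap f (mobius M x).
Proof. by rewrite /mobius -map_pvec -map_mxM !mxE map_pratio. Qed.

Lemma map_quad (u : 'rV[E]_3) (v : 'cV[E]_2) :
  quad (map_mx f u) (map_mx f v) = f (quad u v).
Proof. by rewrite /quad !mxE !(rmorphD, rmorphM, rmorphXn). Qed.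

Lemma map_quad_roots (u : 'rV[E]_3) (x : option E) :
  (omap f x \in quad_roots (map_mx f u)) = (x \in quad_roots u).
Proof. by rewrite !inE -map_pvec map_quad fmorph_eq0. Qed.

Lemma map_conic_mx (A : 'M[E]_2) : map_mx f (conic_mx A) = conic_mx (map_mx f A).
Proof.
apply/matrixP => i j; rewrite !mxE.
by case: i => [[|[|[|]]]] //= i; case: j => [[|[|[|]]]] //= j;
  rewrite ?(rmorphD, rmorphMn, rmorphM, rmorphXn).
Qed.

Lemma map_chord (x y : option E) :
  map_mx f (chord x y) = chord (omap f x) (omap f y).
Proof.
rewrite /chord -!map_pvec; move: (pvec x) (pvec y) => a b.
apply/rowP => i; rewrite !mxE.
by case: i => [[|[|[|]]]] //= i; rewrite ?(rmorphN, rmorphD, rmorphM).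
Qed.

Lemma omap_rmorph_inj : injective (omap f).
Proof. exact/inj_omap/fmorph_inj. Qed.

End BaseChange.

Section LineGeometry.

Variable K : finFieldType.

Lemma lineZ (a : K) (u : 'rV[K]_3) : a != 0 -> line (a *: u) = line u.
Proof.
move=> a0; apply/setP => P; apply/lineP/lineP => -[s [s0 us0 ->]]; exists s; split=> //.
  by move/eqP: us0; rewrite -scalemxAl scaler_eq0 (negPf a0) => /eqP.
by rewrite -scalemxAl us0 scaler0.
Qed.

Lemma quad_rootsZ (a : K) (u : 'rV[K]_3) : a != 0 -> quad_roots (a *: u) = quad_roots u.
Proof. by move=> a0; rewrite !quad_rootsE lineZ. Qed.

Lemma quad_roots_eq (u : 'rV[K]_3) (x y : option K) : u != 0 -> x != y ->
  x \in quad_roots u -> y \in quad_roots u -> quad_roots u = [set x; y].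
Proof.
move=> u0 xy ux uy; have [a uE] := quad_roots_two xy ux uy.
rewrite uE quad_rootsZ ?quad_roots_chord //.
by apply: contraNneq u0 => a0; rewrite uE a0 scale0r.
Qed.

Lemma chordC (x y : option K) : chord x y = chord y x.
Proof.
by apply/rowP => i; rewrite !mxE; case: i => [[|[|[|]]]] //= i; ring.
Qed.

Lemma mobiusZ (a : K) (M : 'M[K]_2) x : a != 0 -> mobius (a *: M) x = mobius M x.
Proof.
by move=> a0; rewrite /mobius -scalemxAl ![fun_of_matrix (a *: _) _ _]mxE pratioMl.
Qed.

End LineGeometry.

(** * Conjugation, and descent of projectivities from [K] to [F] *)

Section LinesAndPairs.

Variables (F K : finFieldType) (iota : {rmorphism F -> K}) (sigma : {rmorphism K -> K}).
Hypotheses (sigmaK : involutive sigma) (sigma_iota : forall a, sigma (iota a) = iota a).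
Hypothesis sigma_fix : forall x, sigma x = x -> exists a, x = iota a.

Local Notation cj := (omap sigma).

Lemma cjK : involutive cj.
Proof. by case=> //= a; rewrite sigmaK. Qed.

Lemma cj_iota x : cj (omap iota x) = omap iota x.
Proof. by case: x => //= a; rewrite sigma_iota. Qed.

Lemma cj_fix x : cj x = x -> exists a, x = omap iota a.
Proof.
case: x => [x [/sigma_fix[a ->]]|_]; first by exists (Some a).
by exists None.
Qed.

Lemma descent m n (B : 'M[K]_(m, n)) :
  map_mx sigma B = B -> exists B0, B = map_mx iota B0.
Proof.
move=> sB; exists (\matrix_(i, j) odflt 0 [pick a | iota a == B i j]).
apply/matrixP => i j; rewrite !mxE; case: pickP => [a /eqP->//|].
have /sigma_fix[a ->] : sigma (B i j) = B i j by rewrite -[in RHS]sB mxE.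
by move/(_ a); rewrite eqxx.
Qed.

(* Hilbert 90 is avoided by rescaling a nonzero entry of [M] to 1. *)
Lemma descent_proj (M : 'M[K]_2) (c : K) : M \in unitmx -> map_mx sigma M = c *: M ->
  exists2 A, A \in unitmx & forall x, mobius (map_mx iota A) x = mobius M x.
Proof.
move=> uM sM.
have [i [j m0]] : exists i j, M i j != 0.
  have : M 0 0 != 0 \/ M 0 1 != 0.
    have := uM; rewrite unitmxE unitfE det_mx2E => d0.
    by apply/orP; apply: contraNT d0; rewrite negb_or !negbK => /andP[/eqP-> /eqP->];
       rewrite !mul0r subrr.
  by case=> ?; [exists 0, 0 | exists 0, 1].
have mE : sigma (M i j) = c * M i j by have /matrixP/(_ i j) := sM; rewrite !mxE.
have c0 : c != 0.
  by apply: contraNneq m0 => c0; rewrite -(fmorph_eq0 sigma) mE c0 mul0r.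
have [|A AE] := @descent _ _ ((M i j)^-1 *: M).
  rewrite map_mxZ fmorphV sM mE scalerA; congr (_ *: M).
  by rewrite invfM mulrAC mulVf // mul1r.
exists A; last by move=> x; rewrite -AE mobiusZ ?invr_eq0.
by rewrite -(map_unitmx iota) -AE unitmxZ ?unitfE ?invr_eq0.
Qed.

(* [conj_type true] describes the pairs cut out by secant lines, and          *)
(* [conj_type false] those cut out by exterior lines.                         *)
Definition conj_type (e : bool) (x y : option K) : bool :=
  if e then (cj x == x) && (cj y == y) else (cj x == y) && (cj y == x).

Lemma conj_typeC e x y : conj_type e x y = conj_type e y x.
Proof. by case: e; rewrite /= andbC. Qed.

(** Conjugation fixes both pairs pointwise or swaps both of them, so a relation between
    corresponding conjugates is one between corresponding points. Secant and exterior lines are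
    treated at once in this way. *)
Lemma conj_type_map2 (P : option K -> option K -> Prop) e x y x' y' :
  conj_type e x y -> conj_type e x' y' ->
  P (cj x) (cj x') -> P (cj y) (cj y') -> P x x' /\ P y y'.
Proof. by case: e => /andP[/eqP-> /eqP->] /andP[/eqP-> /eqP->]. Qed.

(** [M] is the linear map taking the chosen vectors [pvec x], [pvec y] to [pvec x'], [pvec y'].
    Conjugation permutes these vectors exactly, without scalars, so the conjugate of [M] agrees with
    [M] on a basis. *)
Lemma conj_type_pair_transitive e x y x' y' : x != y -> x' != y' ->
  conj_type e x y -> conj_type e x' y' ->
  exists2 A, A \in unitmx &
    mobius (map_mx iota A) x = x' /\ mobius (map_mx iota A) y = y'.
Proof.
move=> xy xy' exy exy'.
pose N := row_mx (pvec x) (pvec y) : 'M_2; pose N' := row_mx (pvec x') (pvec y') : 'M_2.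
have uN : N \in unitmx by rewrite unitmx_vdet -pdetE pdet_eq0.
have uN' : N' \in unitmx by rewrite unitmx_vdet -pdetE pdet_eq0.
pose M := N' *m invmx N; have uM : M \in unitmx by rewrite unitmx_mul uN' unitmx_inv.
have MN : M *m N = N' by rewrite mulmxKV.
have [Mx My] : M *m pvec x = pvec x' /\ M *m pvec y = pvec y'.
  by apply: (@eq_row_mx _ 2 1 1); rewrite -mul_mx_row; exact: MN.
have sM : map_mx sigma M = M.
  suff : map_mx sigma M *m N = M *m N by move/(can_inj (mulmxK uN)).
  rewrite MN; apply: (etrans (@mul_mx_row _ 2 2 1 1 _ _ _)).
  pose P a b := map_mx sigma M *m pvec a = pvec b.
  have [sx sy] : P x x' /\ P y y'.
    by apply: (conj_type_map2 exy exy'); rewrite /P -!map_pvec -map_mxM ?Mx ?My.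
  by rewrite sx sy.
have [|A uA AE] := @descent_proj M 1 uM; first by rewrite scale1r.
exists A => //; rewrite !AE.
by split; apply: (mobius_eq (oner_neq0 _)); rewrite scale1r.
Qed.

Lemma conj_type_quadruple_transitive e x y z t x' y' z' t' :
  x != y -> x' != y' -> z \notin [set x; y] -> z' \notin [set x'; y'] ->
  conj_type e x y -> conj_type e x' y' -> conj_type e z t -> conj_type e z' t' ->
  cross_ratio x y z t = cross_ratio x' y' z' t' ->
  exists2 A, A \in unitmx &
    [/\ mobius (map_mx iota A) x = x', mobius (map_mx iota A) y = y',
        mobius (map_mx iota A) z = z' & mobius (map_mx iota A) t = t'].
Proof.
rewrite !inE !negb_or ![z == _]eq_sym ![z' == _]eq_sym.
move=> xy xy' /andP[xz yz] /andP[xz' yz'] exy exy' ezt ezt' r.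
have [M uM [Mx My Mz]] := mobius_3transitive2 xy xz yz xy' xz' yz'.
(* The fourth point follows from the cross ratio. *)
have Mt : mobius M t = t'.
  apply: (cross_ratio_inj xy' xz' yz').
  by rewrite -r -(cross_ratio_mobius x y z t uM) Mx My Mz.
pose P a b := mobius (map_mx sigma M) a = b.
have [sx sy] : P x x' /\ P y y'.
  by apply: (conj_type_map2 exy exy'); rewrite /P map_mobius ?Mx ?My.
(* For exterior lines the conjugate of [z] is [t], so the image of the fourth point enters here. *)
have [sz _] : P z z' /\ P t t'.
  by apply: (conj_type_map2 ezt ezt'); rewrite /P map_mobius ?Mz ?Mt.
have usM : map_mx sigma M \in unitmx by rewrite map_unitmx.
have [|||c _ sM] := mobius_unique uM usM xy xz yz; rewrite ?Mx ?My ?Mz //.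
have [A uA AE] := descent_proj uM sM.
by exists A => //; rewrite !AE.
Qed.

(** * Lines of both types as pairs of points of PG(1, K) *)

Definition conic_pair (l : {set point F}) : {set option K} :=
  [set x | conic_point x \in line_ext iota l].

Lemma line_ext_line (u : 'rV[F]_3) : u != 0 ->
  line_ext iota (line u) = line (map_mx iota u).
Proof.
move=> u0; apply/setP => P; apply/bigcupP/idP => [[u' /andP[u0' /eqP]]|uP].
  by case/(line_inj u0') => a a0 ->; rewrite map_mxZ lineZ // fmorph_eq0.
by exists u; rewrite // u0 eqxx.
Qed.

Lemma conic_pair_line (u : 'rV[F]_3) : u != 0 ->
  conic_pair (line u) = quad_roots (map_mx iota u).
Proof. by move=> u0; rewrite quad_rootsE /conic_pair line_ext_line. Qed.

Lemma line_ext_conicE l x y :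
  (line_ext iota l :&: conic K == [set conic_point x; conic_point y]) =
  (conic_pair l == [set x; y]).
Proof.
have -> : line_ext iota l :&: conic K = @conic_point K @: conic_pair l.
  apply/setP => P; apply/setIP/imsetP => [[lP /imsetP[z _ PE]]|[z]].
    by exists z; rewrite // inE -PE.
  by rewrite inE => lz ->; rewrite imset_f.
have -> : [set conic_point x; conic_point y] = @conic_point K @: [set x; y].
  by rewrite imsetU1 imset_set1.
by rewrite (inj_eq (imset_inj (@conic_point_inj K))).
Qed.

Lemma conic_pair_act l A : l \in lines F -> A \in unitmx ->
  conic_pair (act_line (pclass (conic_mx A)) l) = mobius (map_mx iota A) @: conic_pair l.
Proof.
move=> /linesP[u u0 ->] uA; have uC := conic_mx_unit uA.
rewrite act_line_line // !conic_pair_line //.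
  by rewrite map_mxM map_invmx map_conic_mx quad_roots_act ?map_unitmx.
by apply: contraNneq u0 => e; rewrite -(mulmxKV uC u) e mul0mx.
Qed.

(** Over [K] both equations are multiples of [chord x y], hence proportional. Their ratio is a
    quotient of entries from [F], so they are proportional over [F]. *)
Lemma conic_pair_inj l m x y : l \in lines F -> m \in lines F -> x != y ->
  conic_pair l = [set x; y] -> conic_pair m = [set x; y] -> l = m.
Proof.
move=> /linesP[u u0 ->] /linesP[w w0 ->] xy; rewrite !conic_pair_line // => uE wE.
have [||a ua] := @quad_roots_two _ (map_mx iota u) x y xy.
- by rewrite uE !inE eqxx.
- by rewrite uE !inE eqxx orbT.
have [||b wb] := @quad_roots_two _ (map_mx iota w) x y xy.
- by rewrite wE !inE eqxx.
- by rewrite wE !inE eqxx orbT.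
have b0 : b != 0.
  by apply: contraNneq w0 => b0; rewrite -(map_mx_eq0 iota) wb b0 scale0r.
have uw : map_mx iota u = (a / b) *: map_mx iota w.
  by rewrite wb scalerA divfK.
have [i wi] : exists i, w 0 i != 0.
  by apply/rV0Pn.
have abE : a / b = iota (u 0 i / w 0 i).
  have /rowP/(_ i) := uw; rewrite !mxE fmorph_div => ->.
  by rewrite mulfK ?fmorph_eq0.
have uE' : u = (u 0 i / w 0 i) *: w.
  by apply: (map_mx_inj (f := iota)); rewrite uw abE map_mxZ.
rewrite uE' lineZ //; apply: contraNneq u0 => e; by rewrite uE' e scale0r.
Qed.

Hypothesis exists_root : forall u : 'rV[F]_3, quad_roots u = set0 ->
  exists x, x \in quad_roots (map_mx iota u).

Definition typed_lines (e : bool) : {set {set point F}} :=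
  if e then secant_lines F else exterior_lines F.

Lemma typed_linesE e l :
  (l \in typed_lines e) = (l \in lines F) && (#|l :&: conic F| == if e then 2 else 0).
Proof. by case: e; rewrite inE. Qed.

(** Roots over [F] are the roots fixed by conjugation. A form without roots over [F] gains one over
    [K] by [exists_root]; its conjugate is a second root, distinct from it because it is not
    fixed. *)
Lemma typed_linesP e l : l \in lines F ->
  reflect (exists x y, [/\ x != y, conj_type e x y & conic_pair l = [set x; y]])
          (l \in typed_lines e).
Proof.
move=> Ll; rewrite typed_linesE Ll /=; apply: (iffP idP); have /linesP[u u0 ->] := Ll;
  have u0' : map_mx iota u != 0 by [rewrite map_mx_eq0];
  rewrite card_line_conic conic_pair_line //; case: e => /=.
- case/cards2P=> x [y [xy uE]]; exists (omap iota x), (omap iota y).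
  have xy' : omap iota x != omap iota y by rewrite (inj_eq (omap_rmorph_inj (f:=iota))).
  rewrite !cj_iota !eqxx; split=> //.
  by apply: quad_roots_eq => //; rewrite map_quad_roots uE !inE eqxx ?orbT.
- rewrite cards_eq0 => /eqP u00; have [x ux] := exists_root u00.
  have ucx : cj x \in quad_roots (map_mx iota u).
    rewrite -(map_quad_roots sigma) in ux.
    congr (_ \in quad_roots _): ux; apply/rowP => i; rewrite !mxE; exact: sigma_iota.
  have xcx : x != cj x.
    apply/eqP => /esym/cj_fix[a xE]; move: ux; rewrite xE map_quad_roots u00 inE //.
  exists x, (cj x); split=> //; last exact: quad_roots_eq.
  by rewrite /conj_type cjK !eqxx.
- case=> x [y [xy /andP[/eqP/cj_fix[a xE] /eqP/cj_fix[b yE]] uE]].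
  have -> : quad_roots u = [set a; b].
    apply/setP => c; rewrite -(map_quad_roots iota) uE xE yE !inE.
    by rewrite !(inj_eq (omap_rmorph_inj (f:=iota))).
  by rewrite cards2 (contraNneq _ xy) // => ab; rewrite xE yE ab.
- case=> x [y [xy /andP[/eqP cx /eqP cy] uE]]; rewrite cards_eq0.
  apply/eqP/setP => c; rewrite [RHS]inE -(map_quad_roots iota) uE !inE.
  by apply: contraNF xy => /orP[]/eqP e; apply/eqP;
    [rewrite -cx -e cj_iota | rewrite -cy -e cj_iota].
Qed.

Lemma typed_lines_pair e l : l \in typed_lines e ->
  exists x y, [/\ x != y, conj_type e x y & conic_pair l = [set x; y]].
Proof. by move=> /[dup] + /typed_linesP; rewrite typed_linesE => /andP[Ll _] /(_ Ll). Qed.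

(** [chord] is symmetric in its endpoints, so it is fixed by conjugation for both types and descends
    to [F]. *)
Lemma exists_typed_line e x y : x != y -> conj_type e x y ->
  exists2 l, l \in typed_lines e & conic_pair l = [set x; y].
Proof.
move=> xy exy; have [|u uE] := @descent _ _ (chord x y).
  rewrite map_chord; move: exy; case: e => /andP[/eqP-> /eqP->] //.
  exact: chordC.
have u0 : u != 0 by rewrite -(map_mx_eq0 iota) -uE chord_neq0.
have pE : conic_pair (line u) = [set x; y].
  by rewrite conic_pair_line // -uE quad_roots_chord.
exists (line u) => //; apply/typed_linesP; first by apply/linesP; exists u.
by exists x, y.
Qed.

(** * Orbits of the group on pairs of lines of one type *)

Local Notation G := (conic_group F).
Local Notation act := (@act_line F).

Lemma typed_lines_sub e : typed_lines e \subset lines F.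
Proof. by apply/subsetP => l; rewrite typed_linesE => /andP[]. Qed.

Lemma typed_lines_act e g l : g \in G -> l \in typed_lines e ->
  act g l \in typed_lines e.
Proof.
case/conic_groupP=> A uA -> el; have Ll := subsetP (typed_lines_sub e) _ el.
have [x [y [xy exy lE]]] := typed_lines_pair el.
apply/typed_linesP; first exact: act_lines.
set B := map_mx iota A; have uB : B \in unitmx by rewrite map_unitmx.
have sB : map_mx sigma B = B by apply/matrixP => i j; rewrite !mxE sigma_iota.
exists (mobius B x), (mobius B y); split.
- by rewrite (inj_eq (mobius_inj uB)).
- rewrite /conj_type -!map_mobius sB !(inj_eq (mobius_inj uB)); exact: exy.
- by rewrite conic_pair_act // lE imsetU1 imset_set1.
Qed.

Lemma typed_lines_transitive e l m : l \in typed_lines e -> m \in typed_lines e ->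
  exists2 g, g \in G & m = act g l.
Proof.
move=> el em; have Ll := subsetP (typed_lines_sub e) _ el.
have Lm := subsetP (typed_lines_sub e) _ em.
have [x [y [xy exy lE]]] := typed_lines_pair el.
have [z [t [zt ezt mE]]] := typed_lines_pair em.
have [A uA [xz yt]] := conj_type_pair_transitive xy zt exy ezt.
exists (pclass (conic_mx A)); first by apply/conic_groupP; exists A.
apply: conic_pair_inj Lm _ zt mE _; first exact: act_lines.
by rewrite conic_pair_act // lE imsetU1 imset_set1 xz yt.
Qed.

Lemma eq_set2 (T : finType) (a b c d : T) : [set a; b] = [set c; d] ->
  (a = c /\ b = d) \/ (a = d /\ b = c).
Proof.
move=> E; have Ha : a \in [set c; d] by rewrite -E !inE eqxx.
have Hb : b \in [set c; d] by rewrite -E !inE eqxx orbT.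
have Hc : c \in [set a; b] by rewrite E !inE eqxx.
have Hd : d \in [set a; b] by rewrite E !inE eqxx orbT.
move: Ha Hb Hc Hd; rewrite !inE.
by do 4 (case/orP=> /eqP ?); subst; auto.
Qed.

(** The choice of labels is immaterial: reversing one pair inverts the cross ratio, reversing both
    preserves it. *)
Lemma line_cross_ratioE l m x y z t S : x != y -> z != t ->
  conic_pair l = [set x; y] -> conic_pair m = [set z; t] ->
  line_cross_ratio iota l m S =
  (S == [set cross_ratio x y z t; pinv (cross_ratio x y z t)]).
Proof.
move=> xy zt lE mE; apply/idP/idP => [|SE].
  case/existsP=> x' /existsP[y' /existsP[z' /existsP[t' /and3P[]]]].
  rewrite !line_ext_conicE lE mE => /eqP/eq_set2 xE /eqP/eq_set2 zE /eqP->.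
  case: xE => -[<- <-]; case: zE => -[<- <-] //.
  - by rewrite cross_ratio_swapr // pinvK setUC.
  - by rewrite cross_ratio_swapl // pinvK setUC.
  - by rewrite cross_ratio_swap2.
apply/existsP; exists x; apply/existsP; exists y.
apply/existsP; exists z; apply/existsP; exists t.
by rewrite !line_ext_conicE lE mE !eqxx.
Qed.

(** Labels are chosen so that the cross ratio is [r] itself rather than its inverse, and so that
    [x], [y], [z] are three distinct points, as needed to pin down a projectivity. *)
Lemma line_cross_ratio_normal e l m r :
  l \in typed_lines e -> m \in typed_lines e -> l != m ->
  line_cross_ratio iota l m [set r; pinv r] ->
  exists x y z t,
    [/\ x != y, conj_type e x y, conj_type e z t & z \notin [set x; y]] /\
    [/\ z != t, conic_pair l = [set x; y], conic_pair m = [set z; t]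
      & cross_ratio x y z t = r].
Proof.
move=> el em lm lmr; have Ll := subsetP (typed_lines_sub e) _ el.
have Lm := subsetP (typed_lines_sub e) _ em.
have [x [y [xy exy lE]]] := typed_lines_pair el.
have [z [t [zt ezt mE]]] := typed_lines_pair em.
wlog rE : z t zt ezt mE / cross_ratio x y z t = r => [IH|].
  move: lmr; rewrite (line_cross_ratioE _ xy zt lE mE) => /eqP/eq_set2[[rE _]|[rE _]].
    exact: (IH z t).
  apply: (IH t z); first by rewrite eq_sym.
  - by rewrite conj_typeC.
  - by rewrite setUC.
  - by rewrite cross_ratio_swapr.
have [zxy|zxy] := boolP (z \in [set x; y]); last by exists x, y, z, t.
(* If [z] lies on the other pair, both pairs are reversed, which preserves the cross ratio. Then [t]
   takes the place of [z]; it cannot lie on that pair as well, since the lines would coincide. *)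
exists y, x, t, z; rewrite cross_ratio_swap2 [y == x]eq_sym [t == z]eq_sym.
rewrite !(conj_typeC _ _ x) !(conj_typeC _ _ z) ![[set _; x]]setUC ![[set _; z]]setUC.
split; split=> //.
apply: contra lm => txy; apply/eqP/(conic_pair_inj Ll Lm xy) => //.
rewrite mE; apply/eqP; rewrite eqEcard !cards2 xy zt leqnn andbT.
by apply/subsetP => w; rewrite !inE => /orP[]/eqP->; move: zxy txy; rewrite !inE.
Qed.

Lemma mem_orbital_cross_ratio e l m l' m' r :
  l \in typed_lines e -> m \in typed_lines e -> l != m ->
  l' \in typed_lines e -> m' \in typed_lines e -> l' != m' ->
  line_cross_ratio iota l m [set r; pinv r] ->
  line_cross_ratio iota l' m' [set r; pinv r] ->
  (l', m') \in orbital G act (l, m).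
Proof.
move=> el em lm el' em' lm' lmr lmr'.
have sL := subsetP (typed_lines_sub e).
have [x [y [z [t [[xy exy ezt zN] [zt lE mE rE]]]]]] :=
  line_cross_ratio_normal el em lm lmr.
have [x' [y' [z' [t' [[xy' exy' ezt' zN'] [zt' lE' mE' rE']]]]]] :=
  line_cross_ratio_normal el' em' lm' lmr'.
have [|A uA [Ax Ay Az At]] :=
  conj_type_quadruple_transitive xy xy' zN zN' exy exy' ezt ezt'.
  by rewrite rE rE'.
apply/orbitalP; exists (pclass (conic_mx A)); first by apply/conic_groupP; exists A.
split.
- apply: conic_pair_inj (sL _ el') _ xy' lE' _; first exact: act_lines (sL _ el).
  by rewrite conic_pair_act ?sL // lE imsetU1 imset_set1 Ax Ay.
- apply: conic_pair_inj (sL _ em') _ zt' mE' _; first exact: act_lines (sL _ em).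
  by rewrite conic_pair_act ?sL // mE imsetU1 imset_set1 Az At.
Qed.

Lemma line_cross_ratio_orbital e l m l' m' S :
  l \in typed_lines e -> m \in typed_lines e -> (l', m') \in orbital G act (l, m) ->
  line_cross_ratio iota l' m' S = line_cross_ratio iota l m S.
Proof.
move=> el em /orbitalP[_ /conic_groupP[A uA ->] [-> ->]].
have sL := subsetP (typed_lines_sub e).
have [x [y [xy _ lE]]] := typed_lines_pair el.
have [z [t [zt _ mE]]] := typed_lines_pair em.
have uB : map_mx iota A \in unitmx by rewrite map_unitmx.
rewrite (line_cross_ratioE _ xy zt lE mE).
rewrite (@line_cross_ratioE _ _ (mobius (map_mx iota A) x) (mobius (map_mx iota A) y)
          (mobius (map_mx iota A) z) (mobius (map_mx iota A) t)).
- by rewrite cross_ratio_mobius.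
- by rewrite (inj_eq (mobius_inj uB)).
- by rewrite (inj_eq (mobius_inj uB)).
- by rewrite conic_pair_act ?sL // lE imsetU1 imset_set1.
- by rewrite conic_pair_act ?sL // mE imsetU1 imset_set1.
Qed.

(** * The cross ratios that occur *)

Definition cross_ratio_params (e : bool) : {set option F} :=
  [set c | (c != Some 1) && (e || (c != Some 0) && (c != None))].

Lemma pratio_eq0 (a b : K) : b != 0 -> (pratio a b == Some 0) = (a == 0).
Proof.
move=> b0; rewrite /pratio (negPf b0) (inj_eq Some_inj).
by rewrite mulf_eq0 invr_eq0 (negPf b0) orbF.
Qed.

Lemma pratio_eq_infty (a b : K) : (pratio a b == None) = (b == 0).
Proof. by rewrite /pratio; case: (b == 0). Qed.

(** Conjugation fixes all four points or reverses both pairs, so it fixes the cross ratio. The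
    values 0 and infinity would force a point common to the two pairs, which distinct exterior lines
    do not have. *)
Lemma line_cross_ratio_rational e l m :
  l \in typed_lines e -> m \in typed_lines e -> l != m ->
  exists2 c, c \in cross_ratio_params e &
    line_cross_ratio iota l m [set omap iota c; pinv (omap iota c)].
Proof.
move=> el em lm; have sL := subsetP (typed_lines_sub e).
have [x [y [xy exy lE]]] := typed_lines_pair el.
have [z [t [zt ezt mE]]] := typed_lines_pair em.
set r := cross_ratio x y z t.
have [c rE] : exists c, r = omap iota c.
  apply: cj_fix; rewrite -map_cross_ratio.
  move: exy ezt; case: (e) => /andP[/eqP-> /eqP->] /andP[/eqP-> /eqP->] //.
  exact: cross_ratio_swap2.
exists c; last by rewrite (line_cross_ratioE _ xy zt lE mE) -/r rE.
have omapE (d : option F) : (c == d) = (r == omap iota d).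
  by rewrite rE (inj_eq (omap_rmorph_inj (f:=iota))).
rewrite inE !omapE /= rmorph1 rmorph0 cross_ratio_neq1 //=.
have [//|ne] := boolP e; rewrite (negPf ne) in exy ezt.
have {exy}[/eqP cx /eqP cy] := andP exy; have {ezt}[/eqP cz /eqP ct] := andP ezt.
(* For exterior lines a common point has a common conjugate, so the two pairs, and with them the
   lines, would be equal. *)
have xzt w : w \in [set z; t] -> x != w.
  move=> wzt; apply: contra lm => /eqP xw.
  apply/eqP/(conic_pair_inj (sL _ el) (sL _ em) xy lE); rewrite mE.
  move: wzt; rewrite !inE => /orP[]/eqP wE; rewrite wE in xw.
    by rewrite -cx -cz xw.
  by rewrite -cx -ct xw setUC.
have xz : x != z by rewrite xzt // !inE eqxx.
have xt : x != t by rewrite xzt // !inE eqxx orbT.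
have yt : y != t by apply: contra xz => /eqP yt; rewrite -cy -ct yt.
have yz : y != z by apply: contra xt => /eqP yz; rewrite -cy -cz yz.
rewrite /r /cross_ratio pratio_eq_infty pratio_eq0 mulf_neq0 ?pdet_eq0 //.
by rewrite mulf_neq0 ?pdet_eq0.
Qed.

Hypothesis norm_surj : forall a : F, a != 0 -> exists t, t * sigma t = iota a.
Hypothesis nonfixed : exists x, sigma x != x.

Lemma pair_of_cross_ratio e c : c \in cross_ratio_params e ->
  exists x y z t, [/\ x != y, z != t, z \notin [set x; y] &
    [/\ conj_type e x y, conj_type e z t & cross_ratio x y z t = omap iota c]].
Proof.
rewrite inE => /andP[c1]; case: e => /= [_|/andP[]].
  (* The cross ratio of infinity, 0, 1, c is c. *)
  exists None, (Some 0), (Some 1), (omap iota c).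
  have SE (a b : K) : (Some a == Some b) = (a == b) by rewrite (inj_eq Some_inj).
  split=> //; last split=> //.
  - apply: contra c1; rewrite -(inj_eq (omap_rmorph_inj (f:=iota))) /= rmorph1 eq_sym.
    by [].
  - by rewrite !inE SE oner_eq0.
  - by rewrite /= rmorph0 !eqxx.
  - by rewrite cj_iota /= rmorph1 !eqxx.
  - rewrite /cross_ratio !pdetE !vdetE !mxE; case: (c) => [a|] /=.
      rewrite -[RHS](pratio_pvec (Some (iota a))) !mxE /=.
      rewrite -[RHS](pratioMl _ _ (_ : -1 != 0)) ?oppr_eq0 ?oner_eq0 //.
      by congr pratio; ring.
    by apply/eqP; rewrite pratio_eq_infty; apply/eqP; ring.
case: c c1 => [c|] //; rewrite !(inj_eq Some_inj) => c1 c0 _.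
have [t tE] := norm_surj c0; have [a sa] := nonfixed.
have c1' : iota c != 1 by rewrite fmorph_eq1.
have c0' : iota c != 0 by rewrite fmorph_eq0.
have st1 : 1 - sigma t != 0.
  rewrite subr_eq0; apply: contra c1' => /eqP st.
  by rewrite -tE -st mulr1 -[t]sigmaK -st rmorph1.
have t1 : 1 - t != 0.
  by rewrite -(fmorph_eq0 sigma) rmorphB rmorph1.
have t0 : t != 0 by apply: contra c0' => /eqP t0; rewrite -tE t0 mul0r.
have asa : a - sigma a != 0 by rewrite subr_eq0 eq_sym.
have saa : sigma a - a != 0 by rewrite subr_eq0.
(* [g] solves $(a - g)/(\sigma a - g) = t$. Multiplied by its conjugate, this equation says that the
   cross ratio of $a, \sigma a, g, \sigma g$ is the norm of [t], which is [c]. Here [t != 1] because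
   [c] is not 1. *)
pose g := (a - t * sigma a) / (1 - t).
have sgE : sigma g = (sigma a - sigma t * a) / (1 - sigma t).
  by rewrite /g fmorph_div !rmorphB rmorphM rmorph1 /= sigmaK.
have ag : a - g = t * (sigma a - a) / (1 - t) by rewrite /g; field.
have asg : a - sigma g = (a - sigma a) / (1 - sigma t) by rewrite sgE; field.
have sag : sigma a - g = (sigma a - a) / (1 - t) by rewrite /g; field.
have sasg : sigma a - sigma g = sigma t * (a - sigma a) / (1 - sigma t).
  by rewrite sgE; field.
have numE : (a - g) * (sigma a - sigma g) = iota c * ((a - sigma g) * (sigma a - g)).
  by rewrite ag sasg asg sag -tE; field; rewrite t1 st1.
have den0 : (a - sigma g) * (sigma a - g) != 0.
  by rewrite asg sag !mulf_neq0 ?invr_eq0.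
have num0 : (a - g) * (sigma a - sigma g) != 0 by rewrite numE mulf_neq0.
exists (Some a), (Some (sigma a)), (Some g), (Some (sigma g)); split.
- by rewrite (inj_eq Some_inj) eq_sym.
- rewrite (inj_eq Some_inj); apply: contra c1' => /eqP gE.
  by apply/eqP/(mulIf den0); rewrite mul1r -numE -gE.
- rewrite !inE !(inj_eq Some_inj) negb_or ![g == _]eq_sym -[_ == g]subr_eq0.
  rewrite -[sigma a == g]subr_eq0.
  by move: num0 den0; rewrite !mulf_eq0 !negb_or => /andP[-> _] /andP[_ ->].
split; [by rewrite /= sigmaK !eqxx | by rewrite /= sigmaK !eqxx |].
rewrite /cross_ratio !pdetE !vdetE !mxE /= !mulr1 !mul1r numE /pratio (negPf den0).
by rewrite mulfK.
Qed.

Lemma exists_lines_cross_ratio e c : c \in cross_ratio_params e ->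
  exists l m, [/\ l \in typed_lines e, m \in typed_lines e, l != m &
    line_cross_ratio iota l m [set omap iota c; pinv (omap iota c)]].
Proof.
case/pair_of_cross_ratio=> x [y [z [t [xy zt zN [exy ezt rE]]]]].
have [l el lE] := exists_typed_line xy exy.
have [m em mE] := exists_typed_line zt ezt.
exists l, m; split=> //; last by rewrite (line_cross_ratioE _ xy zt lE mE) rE.
by apply: contraNneq zN => lm; rewrite -lE lm mE !inE eqxx.
Qed.

Lemma typed_lines_group e : acts_as_group G act (typed_lines e).
Proof.
apply: (acts_as_group_sub (conic_group_acts_on_lines F) (typed_lines_sub e)).
by move=> g l; apply: typed_lines_act.
Qed.

(** Invariance of the cross ratio set gives one inclusion, its completeness the other; images of
    distinct lines stay distinct because group elements can be undone. *)
Lemma orbital_cross_ratio_rel e l m c :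
  l \in typed_lines e -> m \in typed_lines e -> l != m ->
  line_cross_ratio iota l m [set omap iota c; pinv (omap iota c)] ->
  orbital G act (l, m) =
    cross_ratio_rel iota (typed_lines e) (typed_lines e) (omap iota c).
Proof.
move=> el em lm lmc; apply/setP => -[l' m']; rewrite !inE /=.
have lmX : (l, m) \in setX (typed_lines e) (typed_lines e) by rewrite in_setX el.
apply/idP/idP => [lmo|/andP[/andP[el' em'] /andP[lm' lmc']]]; last first.
  exact: mem_orbital_cross_ratio el em lm el' em' lm' lmc lmc'.
rewrite (line_cross_ratio_orbital _ el em lmo) lmc andbT.
have := subsetP (orbital_sub (typed_lines_group e) lmX) _ lmo.
rewrite in_setX => -> /=; apply: contra lm => /eqP lm'.
move: lmo; rewrite lm' => /orbitalP[g Gg [E1 E2]].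
have [_ _ _ /(_ g Gg)[h _ hE]] := typed_lines_group e.
by rewrite -(hE l el) -(hE m em) -E1 -E2.
Qed.

Lemma nondiagonal_orbitals e :
  nondiagonal_relations (typed_lines e) (orbitals G act (typed_lines e)) =
  [set cross_ratio_rel iota (typed_lines e) (typed_lines e) (omap iota c)
     | c in cross_ratio_params e].
Proof.
apply/setP => r; apply/setIdP/imsetP => [[/imsetP[[l m] /setXP[el em] ->] nd]|].
  have lm : l != m.
    apply: contra nd => /eqP ->; apply/subsetP => -[a b] /orbitalP[g Gg [-> ->]].
    by apply: (imset_f (fun x => (x, x))); apply: typed_lines_act.
  have [c ce lmc] := line_cross_ratio_rational el em lm.
  by exists c => //; apply: orbital_cross_ratio_rel.
case=> c /exists_lines_cross_ratio[l [m [el em lm lmc]]] ->.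
rewrite -(orbital_cross_ratio_rel el em lm lmc); split.
  by apply: imset_f; rewrite in_setX el.
apply: contra lm => /subsetP/(_ (l, m)).
by rewrite (orbital_refl (typed_lines_group e)) // => /(_ isT)/imsetP[x _ [-> ->]].
Qed.

Lemma orbitals_symmetric e r : r \in orbitals G act (typed_lines e) -> symmetric_rel r.
Proof.
move=> Rr; have gE := typed_lines_group e.
have flip l m : (l, m) \in r -> (m, l) \in r.
  move=> lmr; have [el em rE] := mem_orbitals gE Rr lmr; rewrite rE.
  have [<-|lm] := eqVneq l m; first exact: (orbital_refl gE).
  have [c _ lmc] := line_cross_ratio_rational el em lm.
  apply: (mem_orbital_cross_ratio el em lm em el _ lmc); first by rewrite eq_sym.
  have [x [y [xy _ lE]]] := typed_lines_pair el.
  have [z [t [zt _ mE]]] := typed_lines_pair em.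
  move: lmc; rewrite (line_cross_ratioE _ xy zt lE mE).
  by rewrite (line_cross_ratioE _ zt xy mE lE) cross_ratioC.
apply/setP => -[l m]; apply/imsetP/idP => [[[a b] abr [-> ->]]|lmr].
  exact: flip.
by exists (m, l) => //; apply: flip.
Qed.

(** The relations correspond to the orbits of inversion on the parameters; the doubled form avoids a
    division by 2. *)
Lemma num_classes_orbitals e :
  (num_classes (typed_lines e) (orbitals G act (typed_lines e))).*2 =
  (#|cross_ratio_params e| + #|[set c in cross_ratio_params e | pinv c == c]|)%N.
Proof.
rewrite /num_classes nondiagonal_orbitals -card_involution_orbits; last 2 first.
- case=> [c|]; rewrite !inE /=; last first.
    by rewrite !(inj_eq Some_inj) eqxx eq_sym oner_eq0; case: e.
  rewrite /pratio; case: (eqVneq c 0) => [->|c0].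
    by rewrite eqxx; case: e; rewrite ?andbF.
  rewrite !(inj_eq Some_inj) !div1r invr_eq1 invr_eq0 (negPf c0); by [].
- by move=> c _; apply: pinvK.
congr _.*2.
(* [Phi] sends an unordered pair of parameters to its relation. It is injective on the pairs that
   occur, since each relation contains some [(l, m)] and two lines have only one cross ratio set. *)
pose Phi (T : {set option F}) := [set lm in setX (typed_lines e) (typed_lines e) |
  (lm.1 != lm.2) && line_cross_ratio iota lm.1 lm.2 (omap iota @: T)].
have pairE c : omap iota @: [set c; pinv c] = [set omap iota c; pinv (omap iota c)].
  by rewrite imsetU1 imset_set1 map_pinv.
have -> : [set cross_ratio_rel iota (typed_lines e) (typed_lines e) (omap iota c)
     | c in cross_ratio_params e] =
    Phi @: [set [set c; pinv c] | c in cross_ratio_params e].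
  by rewrite -imset_comp; apply: eq_imset => c /=; rewrite /Phi pairE.
apply: card_in_imset => _ _ /imsetP[c ce ->] /imsetP[d _ ->] /setP PhiE.
have [l [m [el em lm lmc]]] := exists_lines_cross_ratio ce.
have := PhiE (l, m); rewrite !inE /= el em lm /= !pairE lmc => /esym lmd.
have [x [y [xy _ lE]]] := typed_lines_pair el.
have [z [t [zt _ mE]]] := typed_lines_pair em.
move: lmc lmd; rewrite !(line_cross_ratioE _ xy zt lE mE) => /eqP <-.
by rewrite -!pairE => /eqP/(imset_inj (omap_rmorph_inj (f:=iota))).
Qed.
End LinesAndPairs.

(** * Counting parameters and fixed points of inversion *)

Section CrossRatioParameters.

Variable F : finFieldType.

Lemma card_cross_ratio_params e :
  #|cross_ratio_params F e| = if e then #|F| else (#|F| - 2)%N.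
Proof.
have SE (a b : F) : (Some a == Some b) = (a == b) by rewrite (inj_eq Some_inj).
case: e.
  have -> : cross_ratio_params F true = [set~ Some 1].
    by apply/setP => c; rewrite !inE andbT.
  by rewrite cardsC1 card_option.
have -> : cross_ratio_params F false = ~: [set Some 1; Some 0; None].
  by apply/setP => c; rewrite !inE !negb_or -andbA.
rewrite cardsCs setCK card_option setUC cardsU1 cards2 !inE SE oner_eq0 /=.
by rewrite subSS.
Qed.

(** Inversion swaps 0 and infinity, and $c = 1/c$ means $c^2 = 1$. As 1 is excluded, only -1
    remains, and it is a parameter exactly when it differs from 1. *)
Lemma card_fixed_cross_ratio_params e :
  #|[set c in cross_ratio_params F e | pinv c == c]| = (1 != -1 :> F).
Proof.
have SE (a b : F) : (Some a == Some b) = (a == b) by rewrite (inj_eq Some_inj).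
have -> : [set c in cross_ratio_params F e | pinv c == c] =
    [set Some (-1)] :\ Some 1.
  apply/setP => -[c|]; rewrite !inE ?SE /=; last by rewrite !andbF.
  rewrite andbT /pratio; have [->|c0] := eqVneq c 0.
    by rewrite [0 == -1]eq_sym oppr_eq0 oner_eq0 !andbF.
  rewrite SE orbT andbT; have [//|c1] := eqVneq c 1.
  rewrite /= -(inj_eq (mulIf c0)) divfK // -expr2 eq_sym sqrf_eq1 (negPf c1).
  by [].
have := cardsD1 (Some 1) [set Some (-1 : F)]; rewrite cards1 inE SE.
by case: (1 == -1) => -[].
Qed.

End CrossRatioParameters.

(** * Assembly, with conjugation $x \mapsto x^q$ *)

Theorem mainTheorem1 (q : nat) (F K : finFieldType) (iota : {rmorphism F -> K})
    (hq : prime_power q) (hF : #|F| = q) (hK : #|K| = (q ^ 2)%N) :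
  let Rq := conic_configuration F in
  let Rplus := restriction Rq (secant_lines F) in
  let Rminus := restriction Rq (exterior_lines F) in
  (coherent_configuration (nontangent_lines F) Rq /\ weakly_symmetric Rq) /\
  [/\ secant_lines F \in fibres Rq,
      association_scheme (secant_lines F) Rplus,
      (~~ odd q -> num_classes (secant_lines F) Rplus = (q %/ 2)%N),
      (odd q -> num_classes (secant_lines F) Rplus = ((q + 1) %/ 2)%N)
    & nondiagonal_relations (secant_lines F) Rplus =
        [set cross_ratio_rel iota (secant_lines F) (secant_lines F)
               (omap iota lambda) | lambda : option F & lambda != Some 1]] /\
  [/\ exterior_lines F \in fibres Rq,
      association_scheme (exterior_lines F) Rminus,
      (~~ odd q -> num_classes (exterior_lines F) Rminus = (q %/ 2 - 1)%N),
      (odd q -> num_classes (exterior_lines F) Rminus = ((q - 1) %/ 2)%N)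
    & nondiagonal_relations (exterior_lines F) Rminus =
        [set cross_ratio_rel iota (exterior_lines F) (exterior_lines F)
               (Some (iota lambda)) | lambda : F & (lambda != 0) && (lambda != 1)]].
Proof.
have [sigma sigmaE] := exists_conjugation hq hK.
have sigmaK : involutive sigma.
  by move=> x; rewrite !sigmaE -exprM mulnn -hK expf_card.
have sigma_iota a : sigma (iota a) = iota a.
  by rewrite sigmaE -rmorphXn /= -hF expf_card.
have sigma_fix x : sigma x = x -> exists a, x = iota a.
  by rewrite sigmaE; apply: fixed_conjugation.
have exists_root u := exists_root_over_quadratic iota hF hK (u := u).
have norm_surj (a : F) : a != 0 -> exists t, t * sigma t = iota a.
  by case/(norm_surjective iota hF hK) => t tE; exists t; rewrite sigmaE -exprS.
have nonfixed : exists x, sigma x != x.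
  by have [x xq] := exists_nonfixed iota hF hK; exists x; rewrite sigmaE.
move=> Rq Rplus Rminus.
have actE e g l := typed_lines_act sigmaK sigma_iota sigma_fix exists_root (e := e) (g := g) (l := l).
have trE e l m := typed_lines_transitive sigmaK sigma_iota sigma_fix exists_root (e := e) (l := l) (m := m).
have nontangentE : nontangent_lines F = typed_lines F true :|: typed_lines F false by [].
have subX e : typed_lines F e \subset nontangent_lines F.
  by rewrite nontangentE; case: e; rewrite ?subsetUl ?subsetUr.
have actX : acts_as_group (conic_group F) (@act_line F) (nontangent_lines F).
  apply: (acts_as_group_sub (conic_group_acts_on_lines F)).
    by rewrite nontangentE subUset !typed_lines_sub.
  move=> g l Gg; rewrite nontangentE => /setUP[]/(actE _ _ _ Gg).
    exact: (subsetP (subX true)).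
  exact: (subsetP (subX false)).
have RqE : Rq = orbitals (conic_group F) (@act_line F) (nontangent_lines F) by [].
have restrE e : restriction Rq (typed_lines F e) =
    orbitals (conic_group F) (@act_line F) (typed_lines F e).
  by rewrite RqE (restriction_orbitals actX (subX e)) // => g l; apply: actE.
have diagE e l : l \in typed_lines F e ->
    orbital (conic_group F) (@act_line F) (l, l) = diag (typed_lines F e).
  move=> el; exact: (orbital_diag el (fun g Gg => actE e g l Gg el) (fun m => trE e l m el)).
have symE e r : r \in restriction Rq (typed_lines F e) -> symmetric_rel r.
  by rewrite restrE; apply: (orbitals_symmetric sigmaK sigma_iota sigma_fix exists_root).
have fibE e : typed_lines F e \in fibres Rq.
  (* Each type must be inhabited for its diagonal to be an orbital: infinity and 0 span a secant
     line, a nonfixed element and its conjugate an exterior one. *)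
  have [x [y [xy exy]]] : exists x y, x != y /\ conj_type sigma e x y.
    case: e; first by exists None, (Some 0); rewrite /= rmorph0 eqxx.
    have [x sx] := nonfixed; exists (Some x), (Some (sigma x)).
    by rewrite (inj_eq Some_inj) eq_sym sx /= sigmaK !eqxx.
  have [l el _] := exists_typed_line sigmaK sigma_iota sigma_fix exists_root xy exy.
  have Xl := subsetP (subX e) _ el.
  by rewrite inE -(diagE e l el); apply: imset_f; rewrite in_setX Xl.
have schemeE e : association_scheme (typed_lines F e) (restriction Rq (typed_lines F e)).
  split; last exact: symE.
  rewrite restrE; apply: orbitals_coherent.
  exact: (typed_lines_group sigmaK sigma_iota sigma_fix exists_root).
have numE e := num_classes_orbitals sigmaK sigma_iota sigma_fix exists_root norm_surj nonfixed e.
have nondiagE e := nondiagonal_orbitals sigmaK sigma_iota sigma_fix exists_root norm_surj nonfixed e.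
have q1 := q_gt1 hF.
(* The summand [odd q] counts the fixed point -1 of inversion, present only in odd
   characteristic. *)
have {}numE e : (num_classes (typed_lines F e) (restriction Rq (typed_lines F e))).*2
    = ((if e then q else q - 2) + odd q)%N.
  by rewrite restrE numE card_cross_ratio_params card_fixed_cross_ratio_params
     hF (odd_card_field hq hF).
split; [split; first exact: orbitals_coherent actX | split].
(* The diagonal of a fibre is the orbital of some [(l, m)] and contains it, so [l = m]. By
   transitivity the fibre is the set of all lines of the type of [l]. *)
- move=> Y; rewrite inE => /imsetP[[l m] /setXP[Xl Xm] YE] r.
  have lm : l = m.
    by have := orbital_refl actX Xl Xm; rewrite -[orbital _ _ _]YE => /imsetP[x _ [-> ->]].
  suff [e ->] : exists e, Y = typed_lines F e by apply: symE.
  move: Xl; rewrite nontangentE => /setUP[] el; [exists true|exists false];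
    by apply: diag_inj; rewrite YE -lm; apply: diagE.
- split; [exact: (fibE true) | exact: (schemeE true) | | | ].
  + by move=> q_even; have := numE true; rewrite -/Rplus /=; lia.
  + by move=> q_odd; have := numE true; rewrite -/Rplus /=; lia.
  + rewrite -[Rplus]/(restriction Rq (typed_lines F true)) restrE.
    rewrite -[secant_lines F]/(typed_lines F true) nondiagE.
    by apply/setP => r; apply/imsetP/imsetP => -[c cP ->]; exists c => //;
      move: cP; rewrite !inE andbT.
- split; [exact: (fibE false) | exact: (schemeE false) | | | ].
  + by move=> q_even; have := numE false; rewrite -/Rminus /=; lia.
  + by move=> q_odd; have := numE false; rewrite -/Rminus /=; lia.
  + rewrite -[Rminus]/(restriction Rq (typed_lines F false)) restrE.
    rewrite -[exterior_lines F]/(typed_lines F false) nondiagE.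
    have SE (a b : F) : (Some a == Some b) = (a == b) by rewrite (inj_eq Some_inj).
    apply/setP => r; apply/imsetP/imsetP => -[].
      (* Infinity is not a parameter for exterior lines, so every parameter is the image of an
         element of [F]. *)
      case=> [c|]; rewrite inE ?SE; last by rewrite !andbF.
      by rewrite /= andbT andbC => c01 ->; exists c; rewrite // inE.
    by move=> c; rewrite inE => c01 ->; exists (Some c); rewrite // inE !SE andbT andbC.
Qed.
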